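(* Let $(E,C)$ be a separated graph and $K$ a field with involution. Then there exists a bipartite separated graph $(\widetilde E,\widetilde C)$ such that $$L_K(\widetilde E,\widetilde C)\cong M_2(L_K(E,C)),\qquad C^*(\widetilde E,\widetilde C)\cong M_2(C^*(E,C)).$$ Moreover we have $$L^{\mathrm{ab}}_K(\widetilde E,\widetilde C)\cong M_2(L^{\mathrm{ab}}_K(E,C)),\qquad\mathcal O(\widetilde E,\widetilde C)\cong M_2(\mathcal O(E,C)).$$ (All isomorphisms are $*$-isomorphisms.)
   Context: A separated graph is a pair $(E,C)$, where $E=(E^0,E^1,r,s)$ is a directed graph and $C=\bigsqcup_{v\in E^0}C_v$ with $C_v$ a partition of $r^{-1}(v)$ into pairwise disjoint nonempty subsets ($C_v=\emptyset$ if $r^{-1}(v)=\emptyset$). It is bipartite if $E^0=E^{0,0}\sqcup E^{0,1}$, all arrows go from $E^{0,1}$ to $E^{0,0}$, $r^{-1}(v)\ne\emptyset$ for all $v\in E^{0,0}$ and $s^{-1}(v)\neq\emptyset$ for all $v\in E^{0,1}$. $L_K(E,C)$ is the $*$-algebra over $K$ with generators $v\in E^0$, $e\in E^1$ and relations: $vv'=\delta_{v,v'}v$, $v=v^*$ ($v,v'\in E^0$); $r(e)e=e=es(e)$ ($e\in E^1$); $e^*e'=\delta_{e,e'}s(e)$ for $e,e'\in X$, $X\in C$; $v=\sum_{e\in X}ee^*$ for every finite $X\in C_v$, $v\in E^0$. $C^*(E,C)$ is the universal C*-algebra with the same generators and relations. Let $U$ be the multiplicative semigroup generated by $E^1\sqcup(E^1)^*$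 and $e(u)=uu^*$ for $u\in U$. $L^{\mathrm{ab}}_K(E,C)$ (respectively $\mathcal O(E,C)$) is the quotient of $L_K(E,C)$ (respectively $C^*(E,C)$) by the ideal (respectively closed ideal) generated by the commutators $[e(u),e(u')]$ for all $u,u'\in U$. *)

(* Defs.v *)
From HB Require Import structures.
From mathcomp Require Import all_boot all_order all_algebra.
From mathcomp Require Import complex ring lra.
From mathcomp Require Import all_classical all_reals all_analysis.

Set Implicit Arguments.
Unset Strict Implicit.
Unset Printing Implicit Defensive.
Import Order.TTheory GRing.Theory Num.Theory.
Import numFieldNormedType.Exports.

Local Open Scope classical_set_scope.
Local Open Scope quotient_scope.
Local Open Scope ring_scope.

(** [r^-1(v)] is the set of edges ending at [v].  When it is empty, [partition]
    forces [sg_part v] to be empty, since it only has nonempty members. *)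
Record sepGraph := SepGraph {
  sg_vertex : choiceType;
  sg_edge : choiceType;
  sg_src : sg_edge -> sg_vertex;
  sg_rng : sg_edge -> sg_vertex;
  sg_part : sg_vertex -> set (set sg_edge);
  sg_partP : forall v, partition (sg_part v) id (sg_rng @^-1` [set v])
}.

Definition bipartite (E : sepGraph) : Prop :=
  exists V0 V1 : set (sg_vertex E),
    [/\ V0 `|` V1 = setT,
        V0 `&` V1 = set0,
        forall e, V1 (sg_src e) /\ V0 (sg_rng e),
        forall v, V0 v -> exists e : sg_edge E, sg_rng e = v &
        forall v, V1 v -> exists e : sg_edge E, sg_src e = v].

HB.mixin Record isStarAlgebra (K : fieldType) (theta : involutive_rmorphism K)
    A & GRing.Lmodule K A := {
  amul : A -> A -> A;
  star : A -> A;
  amulA : associative amul;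
  amulDl : left_distributive amul +%R;
  amulDr : right_distributive amul +%R;
  amulZl : forall k a b, amul (k *: a) b = k *: amul a b;
  amulZr : forall k a b, amul a (k *: b) = k *: amul a b;
  starD : {morph star : a b / a + b};
  starZ : forall k a, star (k *: a) = theta k *: star a;
  starM : forall a b, star (amul a b) = amul (star b) (star a);
  starK : involutive star
}.

#[short(type="starAlgType")]
HB.structure Definition StarAlgebra (K : fieldType)
    (theta : involutive_rmorphism K) :=
  {A of GRing.Lmodule K A & isStarAlgebra K theta A}.

Declare Scope staralg_scope.
Delimit Scope staralg_scope with A.
Infix "**" := amul (at level 40, left associativity) : staralg_scope.
Local Open Scope staralg_scope.

Definition star_isomorphic (K : fieldType) (theta : involutive_rmorphism K)
    (A B : starAlgType theta) : Prop :=
  exists f : {linear A -> B},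
    [/\ bijective f, {morph f : a b / a ** b} & {morph f : a / star a}].

Section StarAlgebraTheory.
Variables (K : fieldType) (theta : involutive_rmorphism K).
Variable A : starAlgType theta.
Implicit Types a b : A.

Lemma amul0l b : (0 : A) ** b = 0.
Proof. by rewrite -(scale0r (0 : A)) amulZl !scale0r. Qed.
Lemma amul0r a : a ** (0 : A) = 0.
Proof. by rewrite -(scale0r (0 : A)) amulZr !scale0r. Qed.
Lemma amulNl a b : (- a) ** b = - (a ** b).
Proof. by rewrite -scaleN1r amulZl scaleN1r. Qed.
Lemma amulNr a b : a ** (- b) = - (a ** b).
Proof. by rewrite -scaleN1r amulZr scaleN1r. Qed.
Lemma amulBl a b c : (a - b) ** c = a ** c - b ** c.
Proof. by rewrite amulDl amulNl. Qed.
Lemma amulBr a b c : c ** (a - b) = c ** a - c ** b.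
Proof. by rewrite amulDr amulNr. Qed.
Lemma starN a : star (- a) = - star a.
Proof. by rewrite -scaleN1r starZ rmorphN1 scaleN1r. Qed.
Lemma star0 : star (0 : A) = 0.
Proof. by rewrite -(scale0r (0 : A)) starZ rmorph0 !scale0r. Qed.
Lemma starB a b : star (a - b) = star a - star b.
Proof. by rewrite starD starN. Qed.
Lemma amul_suml (I : Type) (r : seq I) (P : pred I) (F : I -> A) b :
  (\sum_(i <- r | P i) F i) ** b = \sum_(i <- r | P i) F i ** b.
Proof.
by elim/big_rec2: _ => [|i x y _ <-]; rewrite ?amul0l// amulDl.
Qed.
Lemma amul_sumr (I : Type) (r : seq I) (P : pred I) (F : I -> A) a :
  a ** (\sum_(i <- r | P i) F i) = \sum_(i <- r | P i) a ** F i.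
Proof.
by elim/big_rec2: _ => [|i x y _ <-]; rewrite ?amul0r// amulDr.
Qed.
Lemma star_sum (I : Type) (r : seq I) (P : pred I) (F : I -> A) :
  star (\sum_(i <- r | P i) F i) = \sum_(i <- r | P i) star (F i).
Proof.
by elim/big_rec2: _ => [|i x y _ <-]; rewrite ?star0// starD.
Qed.

End StarAlgebraTheory.

(** A copy of ['M[A]_n]: the library makes ['M[A]_n] a module over [A] itself
    when [A] is a ring, whereas here it is a module over the field [K]. *)
Definition mxStar (n : nat) (A : Type) : Type := 'M[A]_n.

Section MatrixStarAlgebra.
Variables (K : fieldType) (theta : involutive_rmorphism K).
Variables (n : nat) (A : starAlgType theta).

HB.instance Definition _ := GRing.Zmodule.copy (mxStar n A) 'M[A]_n.

Implicit Types x y z : mxStar n A.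

Definition mxStar_scale (k : K) x : mxStar n A := map_mx ( *:%R k) x.
Definition mxStar_mul x y : mxStar n A :=
  \matrix_(i, j) \sum_k x i k ** y k j.
Definition mxStar_star x : mxStar n A := \matrix_(i, j) star (x j i).

Fact mxStar_scaleA (a b : K) x :
  mxStar_scale a (mxStar_scale b x) = mxStar_scale (a * b) x.
Proof. by apply/matrixP => i j; rewrite !mxE scalerA. Qed.
Fact mxStar_scale1 : left_id 1 mxStar_scale.
Proof. by move=> x; apply/matrixP => i j; rewrite !mxE scale1r. Qed.
Fact mxStar_scaleDr : right_distributive mxStar_scale +%R.
Proof. by move=> k x y; apply/matrixP => i j; rewrite !mxE scalerDr. Qed.
Fact mxStar_scaleDl x : {morph mxStar_scale^~ x : a b / a + b}.
Proof. by move=> a b; apply/matrixP => i j; rewrite !mxE scalerDl. Qed.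
HB.instance Definition _ := GRing.Zmodule_isLmodule.Build K (mxStar n A)
  mxStar_scaleA mxStar_scale1 mxStar_scaleDr mxStar_scaleDl.

Fact mxStar_mulA : associative mxStar_mul.
Proof.
move=> x y z; apply/matrixP => i j; rewrite !mxE.
under eq_bigr do rewrite mxE amul_sumr.
rewrite exchange_big; apply: eq_bigr => k _ /=.
by rewrite mxE amul_suml; apply: eq_bigr => l _; rewrite amulA.
Qed.
Fact mxStar_mulDl : left_distributive mxStar_mul +%R.
Proof.
move=> x y z; apply/matrixP => i j; rewrite !mxE -big_split/=.
by apply: eq_bigr => k _; rewrite mxE amulDl.
Qed.
Fact mxStar_mulDr : right_distributive mxStar_mul +%R.
Proof.
move=> x y z; apply/matrixP => i j; rewrite !mxE -big_split/=.
by apply: eq_bigr => k _; rewrite mxE amulDr.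
Qed.
Fact mxStar_mulZl (k : K) x y : mxStar_mul (k *: x) y = k *: mxStar_mul x y.
Proof.
apply/matrixP => i j; rewrite !mxE scaler_sumr.
by apply: eq_bigr => l _; rewrite mxE amulZl.
Qed.
Fact mxStar_mulZr (k : K) x y : mxStar_mul x (k *: y) = k *: mxStar_mul x y.
Proof.
apply/matrixP => i j; rewrite !mxE scaler_sumr.
by apply: eq_bigr => l _; rewrite mxE amulZr.
Qed.
Fact mxStar_starD : {morph mxStar_star : x y / x + y}.
Proof. by move=> x y; apply/matrixP => i j; rewrite !mxE starD. Qed.
Fact mxStar_starZ (k : K) x : mxStar_star (k *: x) = theta k *: mxStar_star x.
Proof. by apply/matrixP => i j; rewrite !mxE starZ. Qed.
Fact mxStar_starM x y :
  mxStar_star (mxStar_mul x y) = mxStar_mul (mxStar_star y) (mxStar_star x).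
Proof.
apply/matrixP => i j; rewrite !mxE star_sum.
by apply: eq_bigr => k _; rewrite !mxE starM.
Qed.
Fact mxStar_starK : involutive mxStar_star.
Proof. by move=> x; apply/matrixP => i j; rewrite !mxE starK. Qed.

HB.instance Definition _ := isStarAlgebra.Build K theta (mxStar n A)
  mxStar_mulA mxStar_mulDl mxStar_mulDr mxStar_mulZl mxStar_mulZr
  mxStar_starD mxStar_starZ mxStar_starM mxStar_starK.

End MatrixStarAlgebra.

Section Ideals.
Variables (K : fieldType) (theta : involutive_rmorphism K).
Variable A : starAlgType theta.
Implicit Types (I S : set A) (a b : A).

Record ideal I : Prop := Ideal {
  ideal0 : I 0;
  idealD : forall a b, I a -> I b -> I (a + b);
  idealZ : forall (k : K) a, I a -> I (k *: a);
  ideal_amull : forall a b, I b -> I (a ** b);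
  ideal_amulr : forall a b, I a -> I (a ** b)
}.

Definition ideal_gen S : set A :=
  [set a | forall I, ideal I -> S `<=` I -> I a].

Definition star_closed S : Prop := forall a, S a -> S (star a).

Lemma ideal_genP S : ideal (ideal_gen S).
Proof.
split.
- by move=> I /ideal0.
- by move=> a b Ia Ib I iI SI; apply: (idealD iI); [exact: Ia|exact: Ib].
- by move=> k a Ia I iI SI; apply: (idealZ iI); exact: Ia.
- by move=> a b Ib I iI SI; apply: (ideal_amull iI); exact: Ib.
- by move=> a b Ia I iI SI; apply: (ideal_amulr iI); exact: Ia.
Qed.

Lemma sub_ideal_gen S : S `<=` ideal_gen S.
Proof. by move=> a Sa I _; apply. Qed.

Lemma idealN I a : ideal I -> I a -> I (- a).
Proof. by move=> iI Ia; rewrite -scaleN1r; exact: idealZ. Qed.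

Lemma ideal_star_preimage I : ideal I -> ideal [set a | I (star a)].
Proof.
move=> iI; split=> /=.
- by rewrite star0; exact: ideal0.
- by move=> a b; rewrite starD; exact: idealD.
- by move=> k a; rewrite starZ; exact: idealZ.
- by move=> a b; rewrite starM; exact: ideal_amulr.
- by move=> a b; rewrite starM; exact: ideal_amull.
Qed.

Lemma ideal_gen_star_closed S :
  (forall a, S a -> ideal_gen S (star a)) -> star_closed (ideal_gen S).
Proof.
move=> Sstar a Sa; apply: (Sa [set a | ideal_gen S (star a)]) => //.
exact/ideal_star_preimage/ideal_genP.
Qed.

Record starIdeal := StarIdeal {
  starIdeal_set :> A -> Prop;
  starIdealP : ideal starIdeal_set;
  starIdeal_star : star_closed starIdeal_set
}.

Definition star_ideal_gen S : set A := ideal_gen (S `|` [set star a | a in S]).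

Lemma star_ideal_gen_star_closed S : star_closed (star_ideal_gen S).
Proof.
apply: ideal_gen_star_closed => a [Sa|[b Sb <-]]; apply: sub_ideal_gen.
  by right; exists a.
by rewrite starK; left.
Qed.

Definition starIdeal_gen S : starIdeal :=
  StarIdeal (ideal_genP _) (@star_ideal_gen_star_closed S).

End Ideals.

Section Quotient.
Variables (K : fieldType) (theta : involutive_rmorphism K).
Variables (A : starAlgType theta) (J : starIdeal A).
Implicit Types a b c : A.
Let iJ : ideal J := starIdealP J.

Definition quot_rel : rel A := fun a b => `[< J (a - b) >].

Fact quot_rel_refl : reflexive quot_rel.
Proof. by move=> a; apply/asboolP; rewrite subrr; exact: ideal0. Qed.
Fact quot_rel_sym : symmetric quot_rel.
Proof.
move=> a b; apply/asboolP/asboolP => Jab; rewrite -opprB; exact: idealN.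
Qed.
Fact quot_rel_trans : transitive quot_rel.
Proof.
move=> b a c /asboolP ab /asboolP bc; apply/asboolP.
by rewrite -(subrKA b); exact: idealD.
Qed.
Canonical quot_equiv := EquivRel quot_rel quot_rel_refl quot_rel_sym
  quot_rel_trans.

Definition quotAlg : Type := {eq_quot quot_rel}.
HB.instance Definition _ := Choice.on quotAlg.

Definition quot_proj : A -> quotAlg := \pi_({eq_quot quot_rel}).

Lemma quot_projP a b : quot_proj a = quot_proj b <-> J (a - b).
Proof.
split=> [/eqmodP/asboolP//|Jab].
by apply/eqmodP/asboolP.
Qed.

Lemma quot_projK (x : quotAlg) : quot_proj (repr x) = x.
Proof. exact: reprK. Qed.

Lemma quot_reprK a : J (repr (quot_proj a) - a).
Proof. by apply/quot_projP; exact: quot_projK. Qed.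

Definition quot_add (x y : quotAlg) := quot_proj (repr x + repr y).
Definition quot_opp (x : quotAlg) := quot_proj (- repr x).
Definition quot_scale (k : K) (x : quotAlg) := quot_proj (k *: repr x).
Definition quot_mul (x y : quotAlg) := quot_proj (repr x ** repr y).
Definition quot_star (x : quotAlg) := quot_proj (star (repr x)).

Lemma quot_addE a b : quot_add (quot_proj a) (quot_proj b) = quot_proj (a + b).
Proof. by apply/quot_projP; rewrite opprD addrACA; apply: idealD => //; exact: quot_reprK. Qed.
Lemma quot_oppE a : quot_opp (quot_proj a) = quot_proj (- a).
Proof. by apply/quot_projP; rewrite -opprD; apply: idealN => //; exact: quot_reprK. Qed.
Lemma quot_scaleE k a : quot_scale k (quot_proj a) = quot_proj (k *: a).
Proof. by apply/quot_projP; rewrite -scalerBr; apply: idealZ => //; exact: quot_reprK. Qed.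
Lemma quot_mulE a b : quot_mul (quot_proj a) (quot_proj b) = quot_proj (a ** b).
Proof.
apply/quot_projP; rewrite -(subrKA (repr (quot_proj a) ** b)).
rewrite -amulBr -amulBl; apply: idealD => //.
  by apply: ideal_amull => //; exact: quot_reprK.
by apply: ideal_amulr => //; exact: quot_reprK.
Qed.
Lemma quot_starE a : quot_star (quot_proj a) = quot_proj (star a).
Proof.
by apply/quot_projP; rewrite -starB; apply: starIdeal_star; exact: quot_reprK.
Qed.

Lemma quot_ind (P : quotAlg -> Prop) : (forall a, P (quot_proj a)) -> forall x, P x.
Proof. by move=> h x; rewrite -(quot_projK x). Qed.

Fact quot_addA : associative quot_add.
Proof. by do 3!elim/quot_ind => ?; rewrite !quot_addE addrA. Qed.
Fact quot_addC : commutative quot_add.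
Proof. by do 2!elim/quot_ind => ?; rewrite !quot_addE addrC. Qed.
Fact quot_add0 : left_id (quot_proj 0) quot_add.
Proof. by elim/quot_ind => ?; rewrite !quot_addE add0r. Qed.
Fact quot_addN : left_inverse (quot_proj 0) quot_opp quot_add.
Proof. by elim/quot_ind => ?; rewrite quot_oppE !quot_addE addNr. Qed.
HB.instance Definition _ := GRing.isZmodule.Build quotAlg
  quot_addA quot_addC quot_add0 quot_addN.

Fact quot_scaleA k l x : quot_scale k (quot_scale l x) = quot_scale (k * l) x.
Proof. by elim/quot_ind: x => ?; rewrite !quot_scaleE scalerA. Qed.
Fact quot_scale1 : left_id 1 quot_scale.
Proof. by elim/quot_ind => ?; rewrite !quot_scaleE scale1r. Qed.
Fact quot_scaleDr : right_distributive quot_scale quot_add.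
Proof.
by move=> k; do 2!elim/quot_ind => ?; rewrite !(quot_addE, quot_scaleE) scalerDr.
Qed.
Fact quot_scaleDl x : {morph quot_scale^~ x : k l / k + l >-> quot_add k l}.
Proof. by elim/quot_ind: x => ? k l; rewrite !(quot_addE, quot_scaleE) scalerDl. Qed.
HB.instance Definition _ := GRing.Zmodule_isLmodule.Build K quotAlg
  quot_scaleA quot_scale1 quot_scaleDr quot_scaleDl.

Fact quot_mulA : associative quot_mul.
Proof. by do 3!elim/quot_ind => ?; rewrite !quot_mulE amulA. Qed.
Fact quot_mulDl : left_distributive quot_mul quot_add.
Proof. by do 3!elim/quot_ind => ?; rewrite !(quot_addE, quot_mulE) amulDl. Qed.
Fact quot_mulDr : right_distributive quot_mul quot_add.
Proof. by do 3!elim/quot_ind => ?; rewrite !(quot_addE, quot_mulE) amulDr. Qed.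
Fact quot_mulZl (k : K) x y :
  quot_mul (quot_scale k x) y = quot_scale k (quot_mul x y).
Proof.
by elim/quot_ind: x => ?; elim/quot_ind: y => ?; rewrite !(quot_scaleE, quot_mulE) amulZl.
Qed.
Fact quot_mulZr (k : K) x y :
  quot_mul x (quot_scale k y) = quot_scale k (quot_mul x y).
Proof.
by elim/quot_ind: x => ?; elim/quot_ind: y => ?; rewrite !(quot_scaleE, quot_mulE) amulZr.
Qed.
Fact quot_starD : {morph quot_star : x y / quot_add x y}.
Proof. by do 2!elim/quot_ind => ?; rewrite !(quot_addE, quot_starE) starD. Qed.
Fact quot_starZ (k : K) x :
  quot_star (quot_scale k x) = quot_scale (theta k) (quot_star x).
Proof. by elim/quot_ind: x => ?; rewrite !(quot_scaleE, quot_starE) starZ. Qed.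
Fact quot_starM x y : quot_star (quot_mul x y) = quot_mul (quot_star y) (quot_star x).
Proof.
by elim/quot_ind: x => ?; elim/quot_ind: y => ?; rewrite !(quot_starE, quot_mulE) starM.
Qed.
Fact quot_starK : involutive quot_star.
Proof. by elim/quot_ind => ?; rewrite !quot_starE starK. Qed.
HB.instance Definition _ := isStarAlgebra.Build K theta quotAlg
  quot_mulA quot_mulDl quot_mulDr quot_mulZl quot_mulZr
  quot_starD quot_starZ quot_starM quot_starK.

End Quotient.

Section FreeStarAlgebra.
Variables (K : fieldType) (theta : involutive_rmorphism K) (G : Type).

Inductive star_term : Type :=
| TGen of G
| TZero
| TAdd of star_term & star_term
| TOpp of star_term
| TScale of K & star_term
| TMul of star_term & star_term
| TStar of star_term.

(** The least congruence that makes the axioms of *-algebras hold. *)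
Inductive term_eq : star_term -> star_term -> Prop :=
| teq_refl x : term_eq x x
| teq_sym x y : term_eq x y -> term_eq y x
| teq_trans x y z : term_eq x y -> term_eq y z -> term_eq x z
| teq_congD x x' y y' :
    term_eq x x' -> term_eq y y' -> term_eq (TAdd x y) (TAdd x' y')
| teq_congN x x' : term_eq x x' -> term_eq (TOpp x) (TOpp x')
| teq_congZ k x x' : term_eq x x' -> term_eq (TScale k x) (TScale k x')
| teq_congM x x' y y' :
    term_eq x x' -> term_eq y y' -> term_eq (TMul x y) (TMul x' y')
| teq_congS x x' : term_eq x x' -> term_eq (TStar x) (TStar x')
| teq_addA x y z : term_eq (TAdd x (TAdd y z)) (TAdd (TAdd x y) z)
| teq_addC x y : term_eq (TAdd x y) (TAdd y x)
| teq_add0 x : term_eq (TAdd TZero x) x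
| teq_addN x : term_eq (TAdd (TOpp x) x) TZero
| teq_scaleA k l x : term_eq (TScale k (TScale l x)) (TScale (k * l) x)
| teq_scale1 x : term_eq (TScale 1 x) x
| teq_scaleDr k x y :
    term_eq (TScale k (TAdd x y)) (TAdd (TScale k x) (TScale k y))
| teq_scaleDl k l x :
    term_eq (TScale (k + l) x) (TAdd (TScale k x) (TScale l x))
| teq_mulA x y z : term_eq (TMul x (TMul y z)) (TMul (TMul x y) z)
| teq_mulDl x y z : term_eq (TMul (TAdd x y) z) (TAdd (TMul x z) (TMul y z))
| teq_mulDr x y z : term_eq (TMul x (TAdd y z)) (TAdd (TMul x y) (TMul x z))
| teq_mulZl k x y : term_eq (TMul (TScale k x) y) (TScale k (TMul x y))
| teq_mulZr k x y : term_eq (TMul x (TScale k y)) (TScale k (TMul x y))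
| teq_starD x y : term_eq (TStar (TAdd x y)) (TAdd (TStar x) (TStar y))
| teq_starZ k x : term_eq (TStar (TScale k x)) (TScale (theta k) (TStar x))
| teq_starM x y : term_eq (TStar (TMul x y)) (TMul (TStar y) (TStar x))
| teq_starK x : term_eq (TStar (TStar x)) x.

HB.instance Definition _ := gen_eqMixin star_term.
HB.instance Definition _ := gen_choiceMixin star_term.

Definition term_rel : rel star_term := fun x y => `[< term_eq x y >].

Fact term_rel_refl : reflexive term_rel.
Proof. by move=> x; apply/asboolP; exact: teq_refl. Qed.
Fact term_rel_sym : symmetric term_rel.
Proof. by move=> x y; apply/asboolP/asboolP; exact: teq_sym. Qed.
Fact term_rel_trans : transitive term_rel.
Proof.
by move=> y x z /asboolP xy /asboolP yz; apply/asboolP; exact: teq_trans yz.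
Qed.
Canonical term_equiv := EquivRel term_rel term_rel_refl term_rel_sym
  term_rel_trans.

Definition freeStar : Type := {eq_quot term_rel}.
HB.instance Definition _ := Choice.on freeStar.

Definition free_class : star_term -> freeStar := \pi_({eq_quot term_rel}).
Definition free_gen (g : G) : freeStar := free_class (TGen g).

Lemma free_classP x y : free_class x = free_class y <-> term_eq x y.
Proof.
split=> [/eqmodP/asboolP//|xy].
by apply/eqmodP/asboolP.
Qed.

Lemma free_classK (a : freeStar) : free_class (repr a) = a.
Proof. exact: reprK. Qed.

Lemma free_reprK x : term_eq (repr (free_class x)) x.
Proof. by apply/free_classP; exact: free_classK. Qed.

Lemma free_ind (P : freeStar -> Prop) :
  (forall x, P (free_class x)) -> forall a, P a.
Proof. by move=> h a; rewrite -(free_classK a). Qed.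

Definition free_add (a b : freeStar) := free_class (TAdd (repr a) (repr b)).
Definition free_opp (a : freeStar) := free_class (TOpp (repr a)).
Definition free_scale k (a : freeStar) := free_class (TScale k (repr a)).
Definition free_mul (a b : freeStar) := free_class (TMul (repr a) (repr b)).
Definition free_star (a : freeStar) := free_class (TStar (repr a)).

Lemma free_addE x y :
  free_add (free_class x) (free_class y) = free_class (TAdd x y).
Proof. by apply/free_classP; apply: teq_congD; exact: free_reprK. Qed.
Lemma free_oppE x : free_opp (free_class x) = free_class (TOpp x).
Proof. by apply/free_classP; apply: teq_congN; exact: free_reprK. Qed.
Lemma free_scaleE k x : free_scale k (free_class x) = free_class (TScale k x).
Proof. by apply/free_classP; apply: teq_congZ; exact: free_reprK. Qed.
Lemma free_mulE x y :
  free_mul (free_class x) (free_class y) = free_class (TMul x y).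
Proof. by apply/free_classP; apply: teq_congM; exact: free_reprK. Qed.
Lemma free_starE x : free_star (free_class x) = free_class (TStar x).
Proof. by apply/free_classP; apply: teq_congS; exact: free_reprK. Qed.

Let freeE := (free_addE, free_oppE, free_scaleE, free_mulE, free_starE).

Fact free_addA : associative free_add.
Proof.
by do 3!elim/free_ind => ?; rewrite !freeE; apply/free_classP; constructor.
Qed.
Fact free_addC : commutative free_add.
Proof.
by do 2!elim/free_ind => ?; rewrite !freeE; apply/free_classP; constructor.
Qed.
Fact free_add0 : left_id (free_class TZero) free_add.
Proof.
by elim/free_ind => ?; rewrite !freeE; apply/free_classP; constructor.
Qed.
Fact free_addN : left_inverse (free_class TZero) free_opp free_add.
Proof.
by elim/free_ind => ?; rewrite !freeE; apply/free_classP; constructor.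
Qed.
HB.instance Definition _ := GRing.isZmodule.Build freeStar
  free_addA free_addC free_add0 free_addN.

Fact free_scaleA k l a : free_scale k (free_scale l a) = free_scale (k * l) a.
Proof.
by elim/free_ind: a => ?; rewrite !freeE; apply/free_classP; constructor.
Qed.
Fact free_scale1 : left_id 1 free_scale.
Proof.
by elim/free_ind => ?; rewrite !freeE; apply/free_classP; constructor.
Qed.
Fact free_scaleDr : right_distributive free_scale free_add.
Proof.
by move=> k; do 2!elim/free_ind => ?; rewrite !freeE; apply/free_classP;
  constructor.
Qed.
Fact free_scaleDl a : {morph free_scale^~ a : k l / k + l >-> free_add k l}.
Proof.
by elim/free_ind: a => ? k l; rewrite !freeE; apply/free_classP; constructor.
Qed.
HB.instance Definition _ := GRing.Zmodule_isLmodule.Build K freeStar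
  free_scaleA free_scale1 free_scaleDr free_scaleDl.

Fact free_mulA : associative free_mul.
Proof.
by do 3!elim/free_ind => ?; rewrite !freeE; apply/free_classP; constructor.
Qed.
Fact free_mulDl : left_distributive free_mul free_add.
Proof.
by do 3!elim/free_ind => ?; rewrite !freeE; apply/free_classP; constructor.
Qed.
Fact free_mulDr : right_distributive free_mul free_add.
Proof.
by do 3!elim/free_ind => ?; rewrite !freeE; apply/free_classP; constructor.
Qed.
Fact free_mulZl (k : K) a b :
  free_mul (free_scale k a) b = free_scale k (free_mul a b).
Proof.
by elim/free_ind: a => ?; elim/free_ind: b => ?; rewrite !freeE;
  apply/free_classP; constructor.
Qed.
Fact free_mulZr (k : K) a b :
  free_mul a (free_scale k b) = free_scale k (free_mul a b).
Proof.
by elim/free_ind: a => ?; elim/free_ind: b => ?; rewrite !freeE;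
  apply/free_classP; constructor.
Qed.
Fact free_starD : {morph free_star : a b / free_add a b}.
Proof.
by do 2!elim/free_ind => ?; rewrite !freeE; apply/free_classP; constructor.
Qed.
Fact free_starZ (k : K) a :
  free_star (free_scale k a) = free_scale (theta k) (free_star a).
Proof.
by elim/free_ind: a => ?; rewrite !freeE; apply/free_classP; constructor.
Qed.
Fact free_starM a b : free_star (free_mul a b) = free_mul (free_star b) (free_star a).
Proof.
by elim/free_ind: a => ?; elim/free_ind: b => ?; rewrite !freeE;
  apply/free_classP; constructor.
Qed.
Fact free_starK : involutive free_star.
Proof.
by elim/free_ind => ?; rewrite !freeE; apply/free_classP; constructor.
Qed.
HB.instance Definition _ := isStarAlgebra.Build K theta freeStar
  free_mulA free_mulDl free_mulDr free_mulZl free_mulZr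
  free_starD free_starZ free_starM free_starK.

End FreeStarAlgebra.

Section LeavittAlgebra.
Variables (K : fieldType) (theta : involutive_rmorphism K) (E : sepGraph).

Let F := freeStar theta (sg_vertex E + sg_edge E).
Let p (v : sg_vertex E) : F := free_gen theta (inl v).
Let s (e : sg_edge E) : F := free_gen theta (inr e).

Inductive leavitt_rel : F -> F -> Prop :=
| lrel_vertex v w : leavitt_rel (p v ** p w) (if v == w then p v else 0)
| lrel_vertex_star v : leavitt_rel (p v) (star (p v))
| lrel_rng e : leavitt_rel (p (sg_rng e) ** s e) (s e)
| lrel_src e : leavitt_rel (s e ** p (sg_src e)) (s e)
| lrel_SCK1 v (X : set (sg_edge E)) e f : sg_part v X -> X e -> X f ->
    leavitt_rel (star (s e) ** s f) (if e == f then p (sg_src e) else 0)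
| lrel_SCK2 v (X : set (sg_edge E)) : sg_part v X -> finite_set X ->
    leavitt_rel (p v) (\sum_(e \in X) (s e ** star (s e))).

Definition leavittIdeal : starIdeal F :=
  starIdeal_gen [set c | exists a b, leavitt_rel a b /\ c = a - b].

Definition leavitt : starAlgType theta := quotAlg leavittIdeal.

Definition leavitt_edge (e : sg_edge E) : leavitt := quot_proj leavittIdeal (s e).
Definition leavitt_vertex (v : sg_vertex E) : leavitt :=
  quot_proj leavittIdeal (p v).

End LeavittAlgebra.

Section FinalProjections.
Variables (K : fieldType) (theta : involutive_rmorphism K).
Variables (A : starAlgType theta) (X : Type) (s : X -> A).

Inductive star_semigroup : A -> Prop :=
| ssg_gen x : star_semigroup (s x)
| ssg_star x : star_semigroup (star (s x))
| ssg_mul u u' :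
    star_semigroup u -> star_semigroup u' -> star_semigroup (u ** u').

Definition final_proj (u : A) : A := u ** star u.

Definition final_commutators : set A :=
  [set c | exists u u', [/\ star_semigroup u, star_semigroup u' &
     c = final_proj u ** final_proj u' - final_proj u' ** final_proj u]].

Lemma final_commutators_star c :
  final_commutators c -> star c = - c.
Proof.
move=> [u [u' [_ _ ->]]]; rewrite starB !starM !starK opprB.
by rewrite -!amulA.
Qed.

Lemma final_commutators_star_closed :
  star_closed (ideal_gen final_commutators).
Proof.
apply: ideal_gen_star_closed => c Cc; rewrite (final_commutators_star Cc).
by apply: idealN (ideal_genP _) _; exact: sub_ideal_gen.
Qed.

Definition commutatorIdeal : starIdeal A :=
  StarIdeal (ideal_genP _) final_commutators_star_closed.

End FinalProjections.

Definition leavitt_ab (K : fieldType) (theta : involutive_rmorphism K)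
    (E : sepGraph) : starAlgType theta :=
  quotAlg (commutatorIdeal (@leavitt_edge K theta E)).

Definition complex_conj (R : realType) : involutive_rmorphism R[i] := Num.conj.

Notation complexStarAlgType R := (starAlgType (complex_conj R)).

(** [norm] takes values in [R[i]]; [renorm] is the same number as an element
    of [R]. *)
Definition renorm (R : realType) (V : normedModType R[i]) (x : V) : R :=
  complex.Re `|x|.

Record hilbertSpace (R : realType) := HilbertSpace {
  hilbert_space :> completeNormedModType R[i];
  hilbert_dot : {dot hilbert_space for complex_conj R};
  hilbert_normE : forall x : hilbert_space, `|x| ^+ 2 = hilbert_dot x x
}.

Arguments hilbert_dot {R} H : rename.

Record representation (R : realType) (A : complexStarAlgType R)
    (H : hilbertSpace R) := Representation {
  rep_fun :> A -> H -> H;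
  rep_linear : forall a, linear (rep_fun a);
  rep_continuous : forall a, continuous (rep_fun a);
  repD : forall a b x, rep_fun (a + b) x = rep_fun a x + rep_fun b x;
  repZ : forall k a x, rep_fun (k *: a) x = k *: rep_fun a x;
  repM : forall a b x, rep_fun (a ** b) x = rep_fun a (rep_fun b x);
  rep_star : forall a x y, hilbert_dot H (rep_fun a x) y =
    hilbert_dot H x (rep_fun (star a) y)
}.

Section HilbertTheory.
Variables (R : realType).

Section Renorm.
Variable V : normedModType R[i].
Implicit Types x y : V.

Lemma renormE x : (renorm x)%:C%C = `|x|.
Proof. by rewrite RRe_real// ger0_real. Qed.
Lemma renorm_ge0 x : 0 <= renorm x.
Proof. by rewrite -ler0c renormE. Qed.
Lemma renormD x y : renorm (x + y) <= renorm x + renorm y.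
Proof. by rewrite -lecR rmorphD/= !renormE ler_normD. Qed.
Lemma Re_normK (k : R[i]) : (complex.Re `|k|)%:C%C = `|k|.
Proof. by rewrite RRe_real// ger0_real. Qed.
Lemma renormZ (k : R[i]) x : renorm (k *: x) = complex.Re `|k| * renorm x.
Proof. by apply: complexI; rewrite rmorphM/= !renormE Re_normK normrZ. Qed.
Lemma renorm0 : renorm (0 : V) = 0.
Proof. by rewrite /renorm normr0. Qed.
End Renorm.

Variable H : hilbertSpace R.
Implicit Types x y z : H.

Lemma hilbert_renorm x : (renorm x ^+ 2)%:C%C = hilbert_dot H x x.
Proof. by rewrite rmorphXn/= renormE hilbert_normE. Qed.

Lemma hilbert_dotC x y : hilbert_dot H x y = Num.conj (hilbert_dot H y x).
Proof. by rewrite hermC expr0 mul1r. Qed.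

(* [y], [z] and [x] stand for [T^* x], [T (T^* x)] and [x]. *)
Lemma hilbert_adjoint_bound x y z (M : R) : 0 <= M ->
  hilbert_dot H y y = hilbert_dot H z x -> renorm z <= M * renorm y ->
  renorm y <= M * renorm x.
Proof.
move=> M0 yz zM.
have yyJ : hilbert_dot H x z = hilbert_dot H y y.
  by rewrite hilbert_dotC -yz -hilbert_renorm /Num.conj/= oppr0.
rewrite le_eqVlt in M0; case/predU1P: M0 => [M0|M0].
  have z0 : z = 0.
    apply/eqP; rewrite -normr_eq0 -renormE; apply/eqP; congr (_%:C)%C.
    by apply/eqP; rewrite eq_le renorm_ge0 andbT (le_trans zM)// -M0 mul0r.
  have : hilbert_dot H y y = 0 by rewrite yz z0 linear0l.
  rewrite -hilbert_renorm => /complexI/eqP; rewrite sqrf_eq0 => /eqP ->.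
  by rewrite -M0 mul0r.
have := dnorm_ge0 (hilbert_dot H) ((M^-1)%:C%C *: z - M%:C%C *: x).
rewrite linearBl/= !linearBr/= !linearZl_LR/= !linearZr_LR/= yyJ -yz.
rewrite -!hilbert_renorm.
have cr (r : R) : Num.conj (r%:C)%C = (r%:C)%C by rewrite /Num.conj/= oppr0.
have sE (a b : R[i]) : a *: (b : R[i]^o) = a * b by [].
rewrite !cr !sE -!rmorphM/= -!rmorphB/= ler0c.
rewrite mulVKf ?gt_eqF// mulKf ?gt_eqF// => h.
have h1 : M^-1 * (M^-1 * renorm z ^+ 2) <= renorm y ^+ 2.
  rewrite mulrA -invfM ler_pdivrMl ?mulr_gt0// -expr2 -exprMn.
  by rewrite ler_sqr ?nnegrE ?mulr_ge0 ?renorm_ge0// ltW.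
rewrite -ler_sqr ?nnegrE ?mulr_ge0 ?renorm_ge0 ?(ltW M0)// exprMn.
by rewrite !expr2 in h h1 *; lra.
Qed.
End HilbertTheory.

Lemma isometry_continuous (K : numFieldType) (V W : normedModType K)
  (f : V -> W) : (forall x y, `|f x - f y| = `|x - y|) -> continuous f.
Proof.
move=> fN x; apply/cvgrPdist_lt => e e0; near=> y; rewrite fN.
near: y; move: e e0; apply/cvgrPdist_lt; exact: cvg_id.
Unshelve. all: by end_near. Qed.

Record starSeminorm (R : realType) (A : complexStarAlgType R) := StarSeminorm {
  snorm :> A -> R;
  snorm_ge0 : forall a, 0 <= snorm a;
  snormD : forall a b, snorm (a + b) <= snorm a + snorm b;
  snormZ : forall k a, snorm (k *: a) = complex.Re `|k| * snorm a;
  snormM : forall a b, snorm (a ** b) <= snorm a * snorm b;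
  snorm_star : forall a, snorm (star a) = snorm a
}.

Section Completion.
Variables (R : realType) (A : complexStarAlgType R) (N : starSeminorm A).
Implicit Types (a b : A) (u w : nat -> A).

Lemma snorm0 : N 0 = 0.
Proof. by rewrite -(scale0r (0 : A)) snormZ normr0 mul0r. Qed.
Lemma snormN a : N (- a) = N a.
Proof. by rewrite -scaleN1r snormZ normrN1 mul1r. Qed.
Lemma snormBC a b : N (a - b) = N (b - a).
Proof. by rewrite -opprB snormN. Qed.
Lemma snormB a b : N (a - b) <= N a + N b.
Proof. by rewrite (le_trans (snormD _ _ _))// snormN. Qed.
Lemma snorm_dist a b : `|N a - N b| <= N (a - b).
Proof.
have H1 : N a <= N (a - b) + N b by rewrite -{1}(subrK b a) snormD.
have H2 : N b <= N (b - a) + N a by rewrite -{1}(subrK a b) snormD.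
by rewrite (snormBC b) in H2; rewrite ler_norml; lra.
Qed.

Definition snorm_cauchy u : Prop :=
  forall eps, 0 < eps -> exists n0, forall m n,
    (n0 <= m)%N -> (n0 <= n)%N -> N (u m - u n) < eps.

Definition snorm_null u : Prop :=
  forall eps, 0 < eps -> exists n0, forall n, (n0 <= n)%N -> N (u n) < eps.

Lemma snorm_cauchy_cvg u : snorm_cauchy u -> cvgn (N \o u).
Proof.
move=> cu; apply/cauchy_cvgP/cauchy_ballP => e e0.
have [n0 hn0] := cu _ e0; near_simpl.
exists ([set n | (n0 <= n)%N], [set n | (n0 <= n)%N]).
  by split; exists n0.
move=> [m n] [/= n0m n0n]; rewrite -ball_normE/=.
by rewrite (le_lt_trans (snorm_dist _ _))// hn0.
Qed.

Lemma snorm_cauchy_bounded u : snorm_cauchy u ->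
  exists2 M, 0 < M & forall n, N (u n) <= M.
Proof.
move=> /snorm_cauchy_cvg /cvg_seq_bounded[M [Mr HM]].
exists (`|M| + 1); first by rewrite ltr_wpDl.
move=> n; rewrite (le_trans (ler_norm _))//.
by apply: (HM (`|M| + 1)) => //; rewrite (le_lt_trans (ler_norm _))// ltrDl.
Qed.

Lemma snorm_nullP u : snorm_null u <-> (N \o u) @ \oo --> (0 : R).
Proof.
split=> [nu|/cvgrPdist_lt nu eps e0].
  apply/cvgrPdist_lt => e e0; have [n0 h] := nu _ e0.
  by exists n0 => // n /= n0n; rewrite sub0r normrN ger0_norm ?snorm_ge0// h.
have [n0 _ h] := nu _ e0; exists n0 => n /h /=.
by rewrite sub0r normrN ger0_norm ?snorm_ge0.
Qed.

Lemma snorm_null_le u (v : nat -> R) :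
  (forall n, N (u n) <= v n) -> v @ \oo --> (0 : R) -> snorm_null u.
Proof.
move=> uv v0; apply/snorm_nullP; apply: squeeze_cvgr v0; last exact: cvg_cst.
by near=> n => /=; rewrite snorm_ge0 uv.
Unshelve. all: by end_near. Qed.

Definition snorm_cauchy_pred : {pred nat -> A} :=
  fun u => `[< snorm_cauchy u >].

Fact snorm_cauchy_submod : submod_closed snorm_cauchy_pred.
Proof.
split=> [|k u w /asboolP cu /asboolP cw]; apply/asboolP => e e0.
  by exists 0%N => m n _ _ /=; rewrite subrr snorm0.
have k1 : 0 < complex.Re `|k| + 1 by rewrite ltr_wpDl// -ler0c Re_normK.
have [n0 h0] := cu (e / 2 / (complex.Re `|k| + 1))
  (divr_gt0 (divr_gt0 e0 (ltr0Sn _ 1)) k1).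
have [n1 h1] := cw (e / 2) (divr_gt0 e0 (ltr0Sn _ 1)).
exists (maxn n0 n1) => m n; rewrite !geq_max => /andP[m0 m1] /andP[n0' n1'].
have -> : (k *: u + w) m - (k *: u + w) n = k *: (u m - u n) + (w m - w n).
  by rewrite scalerBr opprD addrACA.
rewrite (le_lt_trans (snormD _ _ _))// [ltRHS]splitr ler_ltD ?h1// snormZ.
rewrite (@le_trans _ _ ((complex.Re `|k| + 1) * N (u m - u n)))//.
  by rewrite ler_wpM2r ?snorm_ge0// lerDl.
by rewrite mulrC -ler_pdivlMr// ltW// h0.
Qed.
HB.instance Definition _ := GRing.isSubmodClosed.Build R[i] (nat -> A)
  snorm_cauchy_pred snorm_cauchy_submod.

Record cauchySeq := CauchySeq {
  cauchySeq_val :> nat -> A;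
  cauchySeq_valP : cauchySeq_val \in snorm_cauchy_pred
}.
HB.instance Definition _ := [isSub for cauchySeq_val].
HB.instance Definition _ := [Choice of cauchySeq by <:].
HB.instance Definition _ := [SubChoice_isSubLmodule of cauchySeq by <:].

Lemma cauchySeqP (u : cauchySeq) : snorm_cauchy u.
Proof. by apply/asboolP; exact: cauchySeq_valP. Qed.

Lemma cauchySeq_eq (u w : cauchySeq) : (forall n, u n = w n) -> u = w.
Proof. by move=> uw; apply/val_inj/funext. Qed.

Fact cauchySeq_mul_subproof (u w : cauchySeq) :
  (fun n => u n ** w n) \in snorm_cauchy_pred.
Proof.
apply/asboolP => e e0.
have [M M0 uM] := snorm_cauchy_bounded (cauchySeqP u).
have [L L0 wL] := snorm_cauchy_bounded (cauchySeqP w).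
have [n0 h0] := cauchySeqP u (divr_gt0 (divr_gt0 e0 (ltr0Sn _ 1)) L0).
have [n1 h1] := cauchySeqP w (divr_gt0 (divr_gt0 e0 (ltr0Sn _ 1)) M0).
exists (maxn n0 n1) => m n; rewrite !geq_max => /andP[m0 m1] /andP[n0' n1'].
rewrite -(subrKA (u n ** w m)) -amulBl -amulBr.
rewrite (le_lt_trans (snormD _ _ _))// [ltRHS]splitr ltrD//.
  rewrite (le_lt_trans (snormM _ _ _))//.
  rewrite (@le_lt_trans _ _ (N (u m - u n) * L))//.
    by rewrite ler_wpM2l ?snorm_ge0.
  by rewrite -ltr_pdivlMr// h0.
rewrite (le_lt_trans (snormM _ _ _))//.
rewrite (@le_lt_trans _ _ (M * N (w m - w n)))//.
  by rewrite ler_wpM2r ?snorm_ge0.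
by rewrite mulrC -ltr_pdivlMr// h1.
Qed.
Definition cauchySeq_mul (u w : cauchySeq) : cauchySeq :=
  CauchySeq (cauchySeq_mul_subproof u w).

Fact cauchySeq_star_subproof (u : cauchySeq) :
  (fun n => star (u n)) \in snorm_cauchy_pred.
Proof.
apply/asboolP => e e0; have [n0 h0] := cauchySeqP u e0.
by exists n0 => m n m0 n0'; rewrite -starB snorm_star h0.
Qed.
Definition cauchySeq_star (u : cauchySeq) : cauchySeq :=
  CauchySeq (cauchySeq_star_subproof u).

Fact cauchySeq_mulA : associative cauchySeq_mul.
Proof. by move=> x y z; apply: cauchySeq_eq => n /=; rewrite amulA. Qed.
Fact cauchySeq_mulDl : left_distributive cauchySeq_mul +%R.
Proof. by move=> x y z; apply: cauchySeq_eq => n /=; rewrite amulDl. Qed.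
Fact cauchySeq_mulDr : right_distributive cauchySeq_mul +%R.
Proof. by move=> x y z; apply: cauchySeq_eq => n /=; rewrite amulDr. Qed.
Fact cauchySeq_mulZl (k : R[i]) (x y : cauchySeq) :
  cauchySeq_mul (k *: x) y = k *: cauchySeq_mul x y.
Proof. by apply: cauchySeq_eq => n /=; rewrite amulZl. Qed.
Fact cauchySeq_mulZr (k : R[i]) (x y : cauchySeq) :
  cauchySeq_mul x (k *: y) = k *: cauchySeq_mul x y.
Proof. by apply: cauchySeq_eq => n /=; rewrite amulZr. Qed.
Fact cauchySeq_starD : {morph cauchySeq_star : x y / x + y}.
Proof. by move=> x y; apply: cauchySeq_eq => n /=; rewrite starD. Qed.
Fact cauchySeq_starZ (k : R[i]) (x : cauchySeq) :
  cauchySeq_star (k *: x) = complex_conj R k *: cauchySeq_star x.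
Proof. by apply: cauchySeq_eq => n /=; rewrite starZ. Qed.
Fact cauchySeq_starM (x y : cauchySeq) :
  cauchySeq_star (cauchySeq_mul x y) =
  cauchySeq_mul (cauchySeq_star y) (cauchySeq_star x).
Proof. by apply: cauchySeq_eq => n /=; rewrite starM. Qed.
Fact cauchySeq_starK : involutive cauchySeq_star.
Proof. by move=> x; apply: cauchySeq_eq => n /=; rewrite starK. Qed.
HB.instance Definition _ := isStarAlgebra.Build R[i] (complex_conj R) cauchySeq
  cauchySeq_mulA cauchySeq_mulDl cauchySeq_mulDr cauchySeq_mulZl cauchySeq_mulZr
  cauchySeq_starD cauchySeq_starZ cauchySeq_starM cauchySeq_starK.

Definition null_set : set cauchySeq := [set u | snorm_null u].

Fact null_ideal : ideal null_set.
Proof.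
split=> /=.
- by move=> e e0; exists 0%N => n _ /=; rewrite snorm0.
- move=> u w /snorm_nullP u0 /snorm_nullP w0.
  apply: (@snorm_null_le _ (fun n => N (u n) + N (w n))) => [n|]; first exact: snormD.
  by rewrite -[0]addr0; exact: cvgD.
- move=> k u /snorm_nullP u0.
  apply: (@snorm_null_le _ (fun n => complex.Re `|k| * N (u n))) => [n|].
    by rewrite -snormZ.
  by rewrite -[0](mulr0 (complex.Re `|k|)); exact: cvgMr.
- move=> w u /snorm_nullP u0.
  have [M M0 wM] := snorm_cauchy_bounded (cauchySeqP w).
  apply: (@snorm_null_le _ (fun n => M * N (u n))) => [n|].
    by rewrite (le_trans (snormM _ _ _))// ler_wpM2r ?snorm_ge0.
  by rewrite -[0](mulr0 M); exact: cvgMr.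
- move=> u w /snorm_nullP u0.
  have [M M0 wM] := snorm_cauchy_bounded (cauchySeqP w).
  apply: (@snorm_null_le _ (fun n => N (u n) * M)) => [n|].
    by rewrite (le_trans (snormM _ _ _))// ler_wpM2l ?snorm_ge0.
  by rewrite -[0](mul0r M); exact: cvgMl.
Qed.

Fact null_star : star_closed null_set.
Proof.
move=> u u0 e e0; have [n0 h] := u0 _ e0; exists n0 => n /h.
by rewrite /= snorm_star.
Qed.

Definition nullIdeal : starIdeal cauchySeq := StarIdeal null_ideal null_star.

Definition completion : Type := quotAlg nullIdeal.
HB.instance Definition _ := StarAlgebra.on completion.

Definition completion_class (u : cauchySeq) : completion :=
  quot_proj nullIdeal u.

Fact cst_cauchy (a : A) : (fun=> a) \in snorm_cauchy_pred.
Proof.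
by apply/asboolP => e e0; exists 0%N => m n _ _; rewrite subrr snorm0.
Qed.

Definition completion_in (a : A) : completion :=
  completion_class (CauchySeq (cst_cauchy a)).

Definition completion_norm (x : completion) : R := limn (N \o repr x).

Lemma completion_norm_cvg (u : cauchySeq) :
  (N \o u) @ \oo --> completion_norm (completion_class u).
Proof.
have cu := snorm_cauchy_cvg (cauchySeqP u).
set w : cauchySeq := repr (completion_class u).
have cw := snorm_cauchy_cvg (cauchySeqP w).
have /snorm_nullP wu : null_set (w - u) by exact: (@quot_reprK _ _ _ nullIdeal).
rewrite /completion_norm -/w.
rewrite (_ : N \o u = (fun n => N (w n) - (N (w n) - N (u n)))); last first.
  by apply/funext => n /=; rewrite opprB addrC subrK.
rewrite -[limn _]subr0; apply: cvgB => //.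
apply/norm_cvg0P; apply: squeeze_cvgr wu; last exact: cvg_cst.
by near=> n => /=; rewrite normr_ge0 snorm_dist.
Unshelve. all: by end_near. Qed.

Lemma completion_ind (P : completion -> Prop) :
  (forall u : cauchySeq, P (completion_class u)) -> forall x, P x.
Proof. exact: quot_ind. Qed.

Lemma completion_norm_star x : completion_norm (star x) = completion_norm x.
Proof.
elim/completion_ind: x => u.
have -> : star (completion_class u) = completion_class (star u).
  exact: quot_starE.
have := @completion_norm_cvg (star u); have := @completion_norm_cvg u.
rewrite (_ : N \o star u = N \o u); last first.
  by apply/funext => n /=; rewrite snorm_star.
by move=> h1 h2; exact: (cvg_unique _ h2 h1).
Qed.

Lemma completion_norm_ge0 x : 0 <= completion_norm x.
Proof.
elim/completion_ind: x => u.
rewrite -(cvg_lim _ (@completion_norm_cvg u))//.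
apply: limr_ge; first exact/snorm_cauchy_cvg/cauchySeqP.
by near=> n; exact: snorm_ge0.
Unshelve. all: by end_near. Qed.

Fact completion_normD x y :
  completion_norm (x + y) <= completion_norm x + completion_norm y.
Proof.
elim/completion_ind: x => u; elim/completion_ind: y => w.
have -> : completion_class u + completion_class w = completion_class (u + w).
  exact: quot_addE.
have uw : (fun n => N (u n) + N (w n)) @ \oo -->
    completion_norm (completion_class u) + completion_norm (completion_class w).
  by apply: cvgD; exact: completion_norm_cvg.
rewrite -(cvg_lim _ (@completion_norm_cvg (u + w)))// -(cvg_lim _ uw)//.
apply: ler_lim; [exact/snorm_cauchy_cvg/cauchySeqP|by apply/cvg_ex; eexists; exact: uw|].
by near=> n; exact: snormD.
Unshelve. all: by end_near. Qed.

Fact completion_normZ (k : R[i]) x :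
  completion_norm (k *: x) = complex.Re `|k| * completion_norm x.
Proof.
elim/completion_ind: x => u.
have -> : k *: completion_class u = completion_class (k *: u).
  exact: quot_scaleE.
have h := @completion_norm_cvg (k *: u).
have h' : (fun n => complex.Re `|k| * N (u n)) @ \oo -->
    complex.Re `|k| * completion_norm (completion_class u).
  by apply: cvgMr; exact: completion_norm_cvg.
apply: (cvg_unique _ h) => //; apply: cvg_trans h'.
rewrite (_ : N \o _ = fun n => complex.Re `|k| * N (u n))//.
by apply/funext => n /=; rewrite -snormZ.
Qed.

Fact completion_norm_eq0 x : completion_norm x = 0 -> x = 0.
Proof.
elim/completion_ind: x => u u0; apply/quot_projP; rewrite subr0 /=.
by apply/snorm_nullP; rewrite -u0; exact: completion_norm_cvg.
Qed.

Fact completion_cnormD x y :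
  (completion_norm (x + y))%:C%C <=
  (completion_norm x)%:C%C + (completion_norm y)%:C%C :> R[i].
Proof. by rewrite -rmorphD/= lecR completion_normD. Qed.
Fact completion_cnormZ (k : R[i]) x :
  (completion_norm (k *: x))%:C%C = `|k| * (completion_norm x)%:C%C.
Proof. by rewrite completion_normZ rmorphM/= Re_normK. Qed.
Fact completion_cnorm_eq0 x :
  (completion_norm x)%:C%C = 0 :> R[i] -> x = 0.
Proof. by move=> /complexI/completion_norm_eq0. Qed.

HB.instance Definition _ := Lmodule_isNormed.Build R[i] completion
  completion_cnormD completion_cnormZ completion_cnorm_eq0.

Lemma completion_normE (x : completion) : `|x| = (completion_norm x)%:C%C.
Proof. by []. Qed.

Definition closed_ideal_gen (S : set completion) : set completion :=
  [set a | forall I : set completion, ideal I -> closed I -> S `<=` I -> I a].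

Lemma closed_ideal_genP S : ideal (closed_ideal_gen S).
Proof.
split.
- by move=> I /ideal0.
- move=> a b Ia Ib I iI cI SI.
  by apply: (idealD iI); [exact: Ia|exact: Ib].
- by move=> k a Ia I iI cI SI; apply: (idealZ iI); exact: Ia.
- by move=> a b Ib I iI cI SI; apply: (ideal_amull iI); exact: Ib.
- by move=> a b Ia I iI cI SI; apply: (ideal_amulr iI); exact: Ia.
Qed.

Lemma closed_ideal_gen_closed S : closed (closed_ideal_gen S).
Proof.
move=> x clx I iI cI SI; apply: (cI) => B /clx[y [Sy By]]; exists y; split => //.
exact: Sy.
Qed.

Lemma sub_closed_ideal_gen S : S `<=` closed_ideal_gen S.
Proof. by move=> a Sa I _ _; apply. Qed.

Lemma completion_star_continuous : continuous (star : completion -> completion).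
Proof.
apply: isometry_continuous => x y.
by rewrite -starB !completion_normE completion_norm_star.
Qed.

Lemma closed_ideal_gen_star_closed (S : set completion) :
  (forall a : completion, S a -> closed_ideal_gen S (star a)) ->
  star_closed (closed_ideal_gen S).
Proof.
move=> Sstar a Sa; apply: (Sa [set a | closed_ideal_gen S (star a)]) => //.
  exact/ideal_star_preimage/closed_ideal_genP.
have /continuous_closedP := completion_star_continuous.
by apply; exact: closed_ideal_gen_closed.
Qed.

Section ClosedCommutators.
Variables (X : Type) (s : X -> completion).

Lemma closed_commutators_star_closed :
  star_closed (closed_ideal_gen (final_commutators s)).
Proof.
apply: closed_ideal_gen_star_closed => c Cc; rewrite (final_commutators_star Cc).
by apply: idealN (closed_ideal_genP _) _; exact: sub_closed_ideal_gen.
Qed.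

Definition closedCommutatorIdeal : starIdeal completion :=
  StarIdeal (closed_ideal_genP _) closed_commutators_star_closed.

End ClosedCommutators.

End Completion.

Section UniversalSeminorm.
Variables (R : realType) (A : complexStarAlgType R).
Implicit Types a b : A.

Definition rep_norms a : set R :=
  [set r | exists (H : hilbertSpace R) (pi : representation A H) (x : H),
     renorm x <= 1 /\ r = renorm (pi a x)].

(** The supremum of the operator norms of [pi a] over all representations [pi]
    of [A] on Hilbert spaces.  Every C*-algebra is one of operators, so
    *-homomorphisms to abstract C*-algebras give the same supremum. *)
Definition universal_norm a : R := sup (rep_norms a).

Definition uniformly_bounded a : Prop :=
  exists M : R, 0 <= M /\ forall (H : hilbertSpace R) (pi : representation A H)
    (x : H), renorm (pi a x) <= M * renorm x.

Lemma rep0 H (pi : representation A H) x : pi 0 x = 0.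
Proof. by rewrite -(scale0r (0 : A)) repZ scale0r. Qed.
Lemma repN H (pi : representation A H) a x : pi (- a) x = - pi a x.
Proof. by rewrite -scaleN1r repZ scaleN1r. Qed.

Lemma rep_scaler H (pi : representation A H) a k x :
  pi a (k *: x) = k *: pi a x.
Proof. exact: (scalable_linear (rep_linear pi a)). Qed.
Lemma rep_subr H (pi : representation A H) a x y :
  pi a (x - y) = pi a x - pi a y.
Proof. exact: (zmod_morphism_linear (rep_linear pi a)). Qed.

Lemma uniformly_bounded0 : uniformly_bounded 0.
Proof.
exists 0; split => // H pi x.
by rewrite rep0 renorm0 mul0r.
Qed.
Lemma uniformly_boundedD a b :
  uniformly_bounded a -> uniformly_bounded b -> uniformly_bounded (a + b).
Proof.
move=> [M [M0 aM]] [L [L0 bL]]; exists (M + L); split; first exact: addr_ge0.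
move=> H pi x; rewrite repD (le_trans (renormD _ _))// mulrDl.
by rewrite lerD.
Qed.
Lemma uniformly_boundedZ k a : uniformly_bounded a -> uniformly_bounded (k *: a).
Proof.
move=> [M [M0 aM]]; exists (complex.Re `|k| * M).
have k0 : 0 <= complex.Re `|k| by rewrite -ler0c Re_normK.
by split=> [|H pi x]; rewrite ?mulr_ge0// repZ renormZ -mulrA ler_wpM2l.
Qed.
Lemma uniformly_boundedN a : uniformly_bounded a -> uniformly_bounded (- a).
Proof. by rewrite -scaleN1r; exact: uniformly_boundedZ. Qed.
Lemma uniformly_boundedM a b :
  uniformly_bounded a -> uniformly_bounded b -> uniformly_bounded (a ** b).
Proof.
move=> [M [M0 aM]] [L [L0 bL]]; exists (M * L); split; first exact: mulr_ge0.
move=> H pi x; rewrite repM (le_trans (aM _ _ _))// -mulrA.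
by rewrite ler_wpM2l.
Qed.
Lemma rep_star_bound a M : 0 <= M ->
  (forall H (pi : representation A H) x, renorm (pi a x) <= M * renorm x) ->
  forall H (pi : representation A H) x, renorm (pi (star a) x) <= M * renorm x.
Proof.
move=> M0 aM H pi x.
apply: (@hilbert_adjoint_bound _ _ _ _ (pi a (pi (star a) x))) => //.
by rewrite [RHS]rep_star.
Qed.
Lemma uniformly_bounded_star a :
  uniformly_bounded a -> uniformly_bounded (star a).
Proof. by move=> [M [M0 aM]]; exists M; split => //; exact: rep_star_bound. Qed.

Section Seminorm.
Hypothesis bounded : forall a, uniformly_bounded a.

Lemma universal_norm_ub a H (pi : representation A H) x :
  renorm x <= 1 -> renorm (pi a x) <= universal_norm a.
Proof.
move=> x1; apply: ub_le_sup; last by exists H, pi, x.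
have [M [M0 aM]] := bounded a; exists M => _ [H' [pi' [y [y1 ->]]]].
by rewrite (le_trans (aM _ _ _))// ler_piMr.
Qed.

Lemma universal_norm_le a M : 0 <= M ->
  (forall H (pi : representation A H) x, renorm x <= 1 ->
     renorm (pi a x) <= M) ->
  universal_norm a <= M.
Proof.
move=> M0 aM; have [S0|/set0P Sn] := eqVneq (rep_norms a) set0.
  by rewrite /universal_norm S0 sup0.
by apply: ge_sup => // _ [H [pi [x [x1 ->]]]]; exact: aM.
Qed.

Lemma universal_norm_ge0 a : 0 <= universal_norm a.
Proof.
have [S0|/set0P[r Sr]] := eqVneq (rep_norms a) set0.
  by rewrite /universal_norm S0 sup0.
have [H [pi [x [x1 _]]]] := Sr.
by rewrite (le_trans (renorm_ge0 _) (universal_norm_ub a pi x1)).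
Qed.

Lemma rep_le_universal_norm a H (pi : representation A H) x :
  renorm (pi a x) <= universal_norm a * renorm x.
Proof.
have [x0|x0] := eqVneq (renorm x) 0.
  have [M [M0 aM]] := bounded a.
  by rewrite x0 mulr0 (le_trans (aM _ _ _))// x0 mulr0.
have xp : 0 < renorm x by rewrite lt_neqAle eq_sym x0 renorm_ge0.
have nk : complex.Re `|((renorm x)^-1)%:C%C : R[i]| = (renorm x)^-1.
  by rewrite ger0_norm// ler0c invr_ge0 ltW.
have := @universal_norm_ub a _ pi (((renorm x)^-1)%:C%C *: x).
rewrite rep_scaler !renormZ nk mulVf// => /(_ (lexx _)).
by rewrite ler_pdivrMl// mulrC.
Qed.

Lemma universal_normD a b :
  universal_norm (a + b) <= universal_norm a + universal_norm b.
Proof.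
apply: universal_norm_le => [|H pi x x1].
  by rewrite addr_ge0 ?universal_norm_ge0.
rewrite repD (le_trans (renormD _ _))// lerD ?universal_norm_ub//.
Qed.

Lemma universal_normZ_le k a :
  universal_norm (k *: a) <= complex.Re `|k| * universal_norm a.
Proof.
have k0 : 0 <= complex.Re `|k| by rewrite -ler0c Re_normK.
apply: universal_norm_le => [|H pi x x1].
  by rewrite mulr_ge0 ?universal_norm_ge0.
by rewrite repZ renormZ ler_wpM2l// universal_norm_ub.
Qed.

Lemma universal_normZ k a :
  universal_norm (k *: a) = complex.Re `|k| * universal_norm a.
Proof.
apply/eqP; rewrite eq_le universal_normZ_le andTb.
have [->|k0] := eqVneq k 0; first by rewrite normr0 mul0r universal_norm_ge0.
have kp : 0 < complex.Re `|k| by rewrite -ltcR Re_normK normr_gt0.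
rewrite -ler_pdivlMl// -{1}(scale1r a) -(mulVf k0) -scalerA.
rewrite (le_trans (universal_normZ_le _ _))// ler_wpM2r ?universal_norm_ge0//.
rewrite le_eqVlt; apply/orP; left; apply/eqP; apply: complexI.
by rewrite fmorphV/= !Re_normK normfV.
Qed.

Lemma universal_normM a b :
  universal_norm (a ** b) <= universal_norm a * universal_norm b.
Proof.
apply: universal_norm_le => [|H pi x x1].
  by rewrite mulr_ge0 ?universal_norm_ge0.
rewrite repM (le_trans (rep_le_universal_norm _ _ _))//.
by rewrite ler_wpM2l ?universal_norm_ge0// universal_norm_ub.
Qed.

Lemma universal_norm_star_le a : universal_norm (star a) <= universal_norm a.
Proof.
apply: universal_norm_le => [|H pi x x1]; first exact: universal_norm_ge0.
rewrite (le_trans (rep_star_bound (universal_norm_ge0 a) _ pi x))//.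
  by move=> H' pi' y; exact: rep_le_universal_norm.
by rewrite ler_piMr ?universal_norm_ge0.
Qed.

Lemma universal_norm_star a : universal_norm (star a) = universal_norm a.
Proof.
apply/eqP; rewrite eq_le universal_norm_star_le /=.
by rewrite -{1}(starK a) universal_norm_star_le.
Qed.

Definition universalSeminorm : starSeminorm A :=
  StarSeminorm universal_norm_ge0 universal_normD universal_normZ
    universal_normM universal_norm_star.

End Seminorm.
End UniversalSeminorm.

Section GraphCStar.
Variables (R : realType) (E : sepGraph).

Let L : complexStarAlgType R := leavitt (complex_conj R) E.
Let p (v : sg_vertex E) : L := leavitt_vertex (complex_conj R) v.
Let s (e : sg_edge E) : L := leavitt_edge (complex_conj R) e.

Lemma leavitt_relP (a b : freeStar (complex_conj R) (sg_vertex E + sg_edge E)) :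
  leavitt_rel a b ->
  quot_proj (leavittIdeal (complex_conj R) E) a = quot_proj _ b.
Proof.
by move=> ab; apply/quot_projP; apply: sub_ideal_gen; left; exists a, b.
Qed.

Lemma rep_vertex_dot H (pi : representation L H) v x :
  hilbert_dot H x (pi (p v) x) = hilbert_dot H (pi (p v) x) (pi (p v) x).
Proof.
have pp : p v ** p v = p v.
  have := leavitt_relP (lrel_vertex (complex_conj R) v v); rewrite eqxx.
  by apply: etrans; exact: quot_mulE.
have ps : star (p v) = p v.
  have /esym := leavitt_relP (lrel_vertex_star (complex_conj R) v).
  by apply: etrans; exact: quot_starE.
by rewrite [RHS]rep_star ps -repM pp.
Qed.

Lemma rep_vertex_contraction H (pi : representation L H) v x :
  renorm (pi (p v) x) <= renorm x.
Proof.
have e1 := rep_vertex_dot pi v x.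
have e2 : hilbert_dot H (pi (p v) x) x = hilbert_dot H (pi (p v) x) (pi (p v) x).
  by rewrite hilbert_dotC e1 -hilbert_renorm /Num.conj/= oppr0.
have := dnorm_ge0 (hilbert_dot H) (x - pi (p v) x).
rewrite linearBl/= !linearBr/= e1 e2 subrr subr0 subr_ge0.
by rewrite -!hilbert_renorm lecR ler_sqr ?nnegrE ?renorm_ge0.
Qed.

Lemma rep_edge_contraction H (pi : representation L H) e x :
  renorm (pi (s e) x) <= renorm x.
Proof.
have [/seteqP[_ /(_ e erefl)[X EX Xe]] _ _] := sg_partP (sg_rng e).
have se : star (s e) ** s e = p (sg_src e).
  have := leavitt_relP (lrel_SCK1 (complex_conj R) EX Xe Xe); rewrite eqxx.
  by apply: etrans; rewrite -quot_mulE -quot_starE.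
have := rep_vertex_contraction pi (sg_src e) x.
rewrite -!(@ler_sqr _ (renorm _)) ?nnegrE ?renorm_ge0// => px.
apply: le_trans px; rewrite -lecR !hilbert_renorm.
by rewrite -rep_vertex_dot rep_star -repM se.
Qed.

Lemma leavitt_bounded (a : L) : uniformly_bounded a.
Proof.
elim/quot_ind: a; elim/free_ind.
elim=> [[v|e]||t IHt t' IHt'|t IHt|k t IHt|t IHt t' IHt'|t IHt].
- by exists 1; split => // H pi x; rewrite mul1r; exact: rep_vertex_contraction.
- by exists 1; split => // H pi x; rewrite mul1r; exact: rep_edge_contraction.
- exact: uniformly_bounded0.
- rewrite -free_addE -quot_addE; exact: uniformly_boundedD.
- rewrite -free_oppE -quot_oppE; exact: uniformly_boundedN.
- rewrite -free_scaleE -quot_scaleE; exact: uniformly_boundedZ.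
- rewrite -free_mulE -quot_mulE; exact: uniformly_boundedM.
- rewrite -free_starE -quot_starE; exact: uniformly_bounded_star.
Qed.

(** The C*-algebra of a set of generators and relations is the Hausdorff
    completion of the *-algebra they present in the seminorm [universal_norm]
    (Blackadar, Operator Algebras, II.8.3); [leavitt_bounded] is what makes
    this supremum finite. *)
Definition graph_cstar : complexStarAlgType R :=
  completion (universalSeminorm leavitt_bounded).

Definition graph_cstar_edge (e : sg_edge E) :
    completion (universalSeminorm leavitt_bounded) :=
  completion_in _ (s e).

Definition tame_graph_cstar : complexStarAlgType R :=
  quotAlg (closedCommutatorIdeal graph_cstar_edge).

End GraphCStar.

(* Main.v *)
From HB Require Import structures.
Require Import Defs.
From mathcomp Require Import all_boot all_order all_algebra.
From mathcomp Require Import complex ring lra.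
From mathcomp Require Import all_classical all_reals all_analysis.

Set Implicit Arguments.
Unset Strict Implicit.
Unset Printing Implicit Defensive.
Import Order.TTheory GRing.Theory Num.Theory.
Import numFieldNormedType.Exports.

Local Open Scope classical_set_scope.
Local Open Scope ring_scope.
Local Open Scope staralg_scope.

(** Split every vertex [v] of [E] into a target [v0] and a source [v1], let each
    edge [e] run from the source copy of its origin to the target copy of its
    end, and add one edge [h_v] from [v1] to [v0] for every [v], forming a block
    of the partition by itself.  The relation of that block makes [h_v] a
    partial isometry with final projection [v0] and initial projection [v1], so
    the [h_v] identify the two corners of the algebra of the new graph, and
    [e h_w^*], for the origin [w] of [e], is an element of the corner of the [v0].  These
    elements satisfy exactly the relations of [E].  Hence the new algebra is
    that of two by two matrices over the old one, by the map [f] that sends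
    [v0], [v1], [e], [h_v] to [v E_00], [v E_11], [e E_01], [v E_01].

    The algebras need not be unital, so the sum of the [h_v] only exists as a
    multiplier.  Surjectivity of [f] is a computation with matrix units.  For
    injectivity, [phi] is the homomorphism back into the corner, and an element
    [y] is recovered from its matrix as the sum over [i], [j] of
    [T_i phi(f(y)_ij) T_j^*], where [T_0] and [T_1] are the sums of the [v0] and
    of the [h_v^*] over a finite set of vertices, taken large enough for [y]
    ([reassembleK]); local units make this work ([leavitt_local_unit]).  The
    result is [leavitt_double].

    The three other isomorphisms follow from this one.  Each is an instance of
    one principle ([quot_mx_iso]): if [f] identifies [A'] with matrices over [A]
    and an ideal [J'] with the matrices over an ideal [J], then it identifies
    the quotient of [A'] with matrices over the quotient of [A].

    - For the quotients by commutators of final projections, an element of the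
      semigroup of the new graph is a matrix with at most one nonzero entry, and
      that entry is, up to vertices and zero, in the semigroup of [E].
      Conversely the commutators of [E] occur in the upper left corner, and
      multiplying by [v E_i0] and [v E_0j] moves them to any other place
      ([commutatorIdeal_entries], [closedCommutatorIdeal_entries]).
    - The completion is a quotient of the algebra of Cauchy sequences, so it is
      enough that the seminorm of a matrix bounds those of its entries and is
      bounded by their sum.  The first bound comes from letting the matrices act
      on a direct sum of copies of a Hilbert space ([amplification]), the second
      from restricting a representation of the matrices to a diagonal corner
      ([rep_matrix_unit_le]). *)

(** * Homomorphisms of star-algebras and matrix units *)

Section StarHom.
Variables (K : fieldType) (theta : involutive_rmorphism K).

Record starHom (A B : starAlgType theta) := StarHom {
  hom_fun :> {linear A -> B};
  homM : {morph hom_fun : a b / a ** b};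
  homS : {morph hom_fun : a / star a}
}.

Variables A B : starAlgType theta.

Definition linear_pack (f : A -> B) (fL : linear f) : {linear A -> B} :=
  HB.pack_for {linear A -> B} f (GRing.isLinear.Build K A B *:%R f fL).

Lemma mk_starHom (f : A -> B) : linear f -> {morph f : a b / a ** b} ->
  {morph f : a / star a} -> exists g : starHom A B, g =1 f.
Proof. by move=> fL fM fS; exists (@StarHom A B (linear_pack fL) fM fS). Qed.

Lemma star_isomorphicP (f : starHom A B) : bijective f -> star_isomorphic A B.
Proof. by move=> bf; exists (hom_fun f); split => //; [exact: homM|exact: homS]. Qed.

End StarHom.

Lemma starHom_inverse (K : fieldType) (theta : involutive_rmorphism K)
    (A B : starAlgType theta) (f : starHom A B) : bijective f ->
  exists g : starHom B A, cancel f g /\ cancel g f.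
Proof.
case=> g fK gK.
have [| | |h hE] := @mk_starHom _ _ B A g.
- by move=> k a b; apply: (can_inj fK); rewrite linearP !gK.
- by move=> a b; apply: (can_inj fK); rewrite homM !gK.
- by move=> a; apply: (can_inj fK); rewrite homS !gK.
by exists h; split=> x; rewrite hE.
Qed.

Section MatrixUnits.
Variables (K : fieldType) (theta : involutive_rmorphism K).
Variables (n : nat) (A : starAlgType theta).
Implicit Types (a b : A) (i j k l : 'I_n) (x y : mxStar n A).

(** The matrix unit [E_ij] with coefficient [a]: without a unit in [A] there is
    no [E_ij] alone. *)
Definition emx a i j : mxStar n A :=
  \matrix_(k, l) if (k == i) && (l == j) then a else 0.

Lemma emxE a i j k l : emx a i j k l = if (k == i) && (l == j) then a else 0.
Proof. by rewrite mxE. Qed.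

Lemma emx_linear i j : linear (fun a => emx a i j).
Proof.
move=> k a b; apply/matrixP => i' j'; rewrite !mxE.
by case: ifP => // _; rewrite scaler0 addr0.
Qed.

Lemma mx_mulE x y i j : (x ** y) i j = \sum_k x i k ** y k j.
Proof. by rewrite mxE. Qed.
Lemma mx_starE x i j : star x i j = star (x j i).
Proof. by rewrite mxE. Qed.
Lemma mx_addE x y i j : (x + y) i j = x i j + y i j.
Proof. by rewrite mxE. Qed.
Lemma mx_scaleE (c : K) x i j : (c *: x) i j = c *: x i j.
Proof. by rewrite mxE. Qed.
Lemma mx_zeroE i j : (0 : mxStar n A) i j = 0.
Proof. by rewrite mxE. Qed.

Lemma mx_sumE (m : nat) (F : 'I_m -> mxStar n A) i j :
  (\sum_k F k) i j = \sum_k F k i j.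
Proof. by elim/big_rec2: _ => [|k x y _ <-]; rewrite mxE. Qed.

Lemma emx_mul a b i j k l :
  emx a i j ** emx b k l = if j == k then emx (a ** b) i l else 0.
Proof.
apply/matrixP => i' j'; rewrite mx_mulE (bigD1 j)//= big1 ?addr0 => [|m mj].
  rewrite !emxE eqxx andbT; have [_|jk] := eqVneq j k.
    by rewrite emxE; case: (i' == i); case: (j' == l); rewrite ?amul0l ?amul0r.
  by rewrite /= amul0r mxE.
by rewrite emxE (negbTE mj) andbF amul0l.
Qed.

Lemma emx_star a i j : star (emx a i j) = emx (star a) j i.
Proof.
apply/matrixP => i' j'; rewrite mx_starE !emxE andbC.
by case: ifP => // _; rewrite star0.
Qed.

Lemma emx0 i j : emx 0 i j = 0.
Proof. by apply/matrixP => i' j'; rewrite emxE mxE; case: ifP. Qed.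

Lemma emxD a b i j : emx (a + b) i j = emx a i j + emx b i j.
Proof. by have := emx_linear i j 1 a b; rewrite !scale1r. Qed.
Lemma emxZ c a i j : emx (c *: a) i j = c *: emx a i j.
Proof. by have := emx_linear i j c a 0; rewrite emx0 !addr0. Qed.
Lemma emxB a b i j : emx (a - b) i j = emx a i j - emx b i j.
Proof. by rewrite emxD -scaleN1r emxZ scaleN1r. Qed.

Lemma cornerP i : exists f : starHom A (mxStar n A), forall a, f a = emx a i i.
Proof.
apply: mk_starHom; first exact: emx_linear.
  by move=> a b; rewrite emx_mul eqxx.
by move=> a; rewrite emx_star.
Qed.

Lemma mx_emx_sum x : x = \sum_i \sum_j emx (x i j) i j.
Proof.
apply/matrixP => k l.
rewrite [RHS]mx_sumE (bigD1 k)//= [X in _ + X]big1 ?addr0 => [|i ik].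
  rewrite [RHS]mx_sumE (bigD1 l)//= [X in _ + X]big1 ?addr0 => [|j jl].
    by rewrite emxE !eqxx.
  by rewrite emxE (eq_sym l) (negbTE jl) andbF.
by rewrite [LHS]mx_sumE big1// => j _; rewrite emxE (eq_sym k) (negbTE ik).
Qed.

End MatrixUnits.

(** * Ideals and quotients of matrix algebras *)

Section MatrixIdeals.
Variables (K : fieldType) (theta : involutive_rmorphism K).
Variables (n : nat) (A' A : starAlgType theta) (f : starHom A' (mxStar n A)).

(** With [mx_units_ideal], this lets membership in a generated ideal pass
    between an algebra and its matrices: a generated ideal is contained in any
    ideal that contains the generators, and the two lemmas supply the ideals to
    compare with. *)
Lemma mx_entries_ideal (J : set A) : ideal J ->
  ideal [set x | forall i j, J (f x i j)].
Proof.
move=> iJ; have sumJ (F : 'I_n -> A) : (forall k, J (F k)) -> J (\sum_k F k).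
  move=> JF; elim/big_rec: _ => [|k x _ Jx]; first exact: ideal0.
  exact: idealD.
split=> /=.
- by move=> i j; rewrite linear0 mx_zeroE; exact: ideal0.
- move=> a b Ja Jb i j; rewrite linearD mx_addE; exact: idealD.
- move=> k a Ja i j; rewrite linearZ mx_scaleE; exact: idealZ.
- move=> a b Jb i j; rewrite homM mx_mulE; apply: sumJ => k; exact: ideal_amull.
- move=> a b Ja i j; rewrite homM mx_mulE; apply: sumJ => k; exact: ideal_amulr.
Qed.

Variable g : mxStar n A -> A'.
Hypotheses (fK : cancel f g) (gK : cancel g f).

(** Multiplying [b E_ij] by [a] on the left is multiplying it by [a E_ii], which
    exists without a unit in [A]. *)
Lemma mx_units_ideal (J' : set A') : ideal J' ->
  ideal [set c | forall i j, J' (g (emx c i j))].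
Proof.
move=> iJ; have gE x y : f y = x -> g x = y by move=> <-; rewrite fK.
split=> /=.
- by move=> i j; rewrite emx0 (gE _ 0) ?linear0//; exact: ideal0.
- move=> a b Ja Jb i j; rewrite (gE _ (g (emx a i j) + g (emx b i j))).
    exact: idealD.
  by rewrite linearD !gK emxD.
- move=> k a Ja i j; rewrite (gE _ (k *: g (emx a i j))); first exact: idealZ.
  by rewrite linearZ /= gK emxZ.
- move=> a b Jb i j; rewrite (gE _ (g (emx a i i) ** g (emx b i j))).
    exact: ideal_amull.
  by rewrite homM !gK emx_mul eqxx.
- move=> a b Ja i j; rewrite (gE _ (g (emx a i j) ** g (emx b j j))).
    exact: ideal_amulr.
  by rewrite homM !gK emx_mul eqxx.
Qed.

Lemma mx_units_sum (J' : set A') x : ideal J' ->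
  (forall i j, J' (g (emx (f x i j) i j))) -> J' x.
Proof.
move=> iJ Jx; have sumJ (F : 'I_n -> A') : (forall k, J' (F k)) -> J' (\sum_k F k).
  move=> JF; elim/big_rec: _ => [|k y _ Jy]; first exact: ideal0.
  exact: idealD.
have -> : x = \sum_i \sum_j g (emx (f x i j) i j).
  apply: (can_inj fK); rewrite [LHS]mx_emx_sum linear_sum/=.
  by apply: eq_bigr => i _; rewrite linear_sum/=; apply: eq_bigr => j _; rewrite gK.
by apply: (sumJ) => i; exact: sumJ.
Qed.

End MatrixIdeals.

Section QuotientMorphism.
Variables (K : fieldType) (theta : involutive_rmorphism K).
Variables (A : starAlgType theta) (J : starIdeal A).

Lemma quot_projD (x y : A) :
  quot_proj J (x + y) = quot_proj J x + quot_proj J y.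
Proof. by rewrite -quot_addE. Qed.
Lemma quot_projM (x y : A) :
  quot_proj J (x ** y) = quot_proj J x ** quot_proj J y.
Proof. by rewrite -quot_mulE. Qed.
Lemma quot_projS (x : A) : quot_proj J (star x) = star (quot_proj J x).
Proof. by rewrite -quot_starE. Qed.
Lemma quot_projZ k (x : A) : quot_proj J (k *: x) = k *: quot_proj J x.
Proof. by rewrite -quot_scaleE. Qed.
Lemma quot_proj0 : quot_proj J 0 = 0.
Proof. by []. Qed.
Lemma quot_sumE m (F : 'I_m -> A) :
  quot_proj J (\sum_k F k) = \sum_k quot_proj J (F k).
Proof. by elim/big_rec2: _ => [|k x y _ <-]; rewrite ?quot_proj0// quot_projD. Qed.

End QuotientMorphism.

Section QuotientMatrix.
Variables (K : fieldType) (theta : involutive_rmorphism K).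
Variables (n : nat) (A' A : starAlgType theta).
Variables (J' : starIdeal A') (J : starIdeal A).
Variable f : starHom A' (mxStar n A).
Hypothesis f_bij : bijective f.
Hypothesis fJ : forall x, J' x <-> forall i j, J (f x i j).

Let F (x : quotAlg J') : mxStar n (quotAlg J) :=
  \matrix_(i, j) quot_proj J (f (repr x) i j).

Let FE x i j : F (quot_proj J' x) i j = quot_proj J (f x i j).
Proof.
rewrite mxE; apply/quot_projP; move: i j.
have := @quot_reprK _ _ _ J' x => /fJ h i j.
by have := h i j; rewrite linearB mxE [in X in _ + X]mxE.
Qed.

(** The value on classes is part of the conclusion because for completions it
    gives the entries of the isomorphism on the image of [A'] and their norms. *)
Lemma quot_mx_iso : exists g : starHom (quotAlg J') (mxStar n (quotAlg J)),
  bijective g /\ forall x i j, g (quot_proj J' x) i j = quot_proj J (f x i j).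
Proof.
have FL : linear F.
  move=> k x y; elim/quot_ind: x => x; elim/quot_ind: y => y.
  rewrite -(quot_projZ J' k x) -(quot_projD J' (k *: x) y).
  apply/matrixP => i j; rewrite mx_addE mx_scaleE !FE linearP mx_addE mx_scaleE.
  by rewrite quot_projD quot_projZ.
have FM : {morph F : x y / x ** y}.
  move=> x y; elim/quot_ind: x => x; elim/quot_ind: y => y.
  apply/matrixP => i j; rewrite -(quot_projM J' x y) FE homM !mx_mulE quot_sumE.
  by apply: eq_bigr => k _; rewrite !FE quot_projM.
have FS : {morph F : x / star x}.
  move=> x; elim/quot_ind: x => x.
  by apply/matrixP => i j; rewrite -(quot_projS J' x) FE homS !mx_starE FE quot_projS.
have [g gE] := mk_starHom FL FM FS; exists g; split; last first.
  by move=> x i j; rewrite gE FE.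
have [h hK Kh] := f_bij.
pose G (y : mxStar n (quotAlg J)) := quot_proj J' (h (\matrix_(i, j) repr (y i j))).
exists G => x; last first.
  by apply/matrixP => i j; rewrite gE FE Kh mxE quot_projK.
elim/quot_ind: x => x; apply/quot_projP/fJ => i j.
rewrite linearB mxE [in X in _ + X]mxE Kh mxE gE FE.
exact: quot_reprK.
Qed.

End QuotientMatrix.

(** * The universal property of the Leavitt algebra *)

Section StarHomTheory.
Variables (K : fieldType) (theta : involutive_rmorphism K).
Variables (A B : starAlgType theta) (f : starHom A B).

Lemma hom_fsum (I : choiceType) (X : set I) (F : I -> A) : finite_set X ->
  f (\sum_(e \in X) F e) = \sum_(e \in X) f (F e).
Proof. by move=> fX; rewrite !fsbig_finite//= raddf_sum. Qed.

End StarHomTheory.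

Section FreeLift.
Variables (K : fieldType) (theta : involutive_rmorphism K) (G : Type).
Variables (B : starAlgType theta) (g : G -> B).

Fixpoint term_eval (t : star_term K G) : B :=
  match t with
  | TGen x => g x
  | TZero => 0
  | TAdd t u => term_eval t + term_eval u
  | TOpp t => - term_eval t
  | TScale k t => k *: term_eval t
  | TMul t u => term_eval t ** term_eval u
  | TStar t => star (term_eval t)
  end.

Lemma term_eval_eq t u : term_eq theta t u -> term_eval t = term_eval u.
Proof.
elim=> //=; do ?by move=> *; congruence.
- by move=> *; rewrite addrA.
- by move=> *; rewrite addrC.
- by move=> *; rewrite add0r.
- by move=> *; rewrite addNr.
- by move=> *; rewrite scalerA.
- by move=> *; rewrite scale1r.
- by move=> *; rewrite scalerDr.
- by move=> *; rewrite scalerDl.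
- by move=> *; rewrite amulA.
- by move=> *; rewrite amulDl.
- by move=> *; rewrite amulDr.
- by move=> *; rewrite amulZl.
- by move=> *; rewrite amulZr.
- by move=> *; rewrite starD.
- by move=> *; rewrite starZ.
- by move=> *; rewrite starM.
- by move=> *; rewrite starK.
Qed.

Lemma free_lift : exists f : starHom (freeStar theta G) B,
  forall x, f (free_gen theta x) = g x.
Proof.
pose F (a : freeStar theta G) := term_eval (repr a).
have FE t : F (free_class theta t) = term_eval t.
  exact/term_eval_eq/free_reprK.
have FL : linear F.
  move=> k a b; elim/free_ind: a => a; elim/free_ind: b => b.
  have -> : k *: free_class theta a + free_class theta b =
    free_class theta (TAdd (TScale k a) b) by rewrite -free_addE -free_scaleE.
  by rewrite !FE.
have FM : {morph F : a b / a ** b}.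
  move=> a b; elim/free_ind: a => a; elim/free_ind: b => b.
  have -> : free_class theta a ** free_class theta b =
    free_class theta (TMul a b) by rewrite -free_mulE.
  by rewrite !FE.
have FS : {morph F : a / star a}.
  move=> a; elim/free_ind: a => a.
  have -> : star (free_class theta a) = free_class theta (TStar a).
    by rewrite -free_starE.
  by rewrite !FE.
have [f fE] := mk_starHom FL FM FS; exists f => x.
by rewrite fE FE.
Qed.

End FreeLift.

Section QuotientLift.
Variables (K : fieldType) (theta : involutive_rmorphism K).
Variables (A B : starAlgType theta) (J : starIdeal A) (f : starHom A B).

Lemma hom_kernel_ideal : ideal [set a | f a = 0].
Proof.
split=> /=; first exact: linear0.
- by move=> a b fa fb; rewrite linearD/= fa fb addr0.
- by move=> k a fa; rewrite linearZ/= fa scaler0.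
- by move=> a b fb; rewrite homM fb amul0r.
- by move=> a b fa; rewrite homM fa amul0l.
Qed.

Lemma quot_lift : (forall a, J a -> f a = 0) ->
  exists h : starHom (quotAlg J) B, forall a, h (quot_proj J a) = f a.
Proof.
move=> fJ; pose F (x : quotAlg J) := f (repr x).
have FE a : F (quot_proj J a) = f a.
  apply/eqP; rewrite -subr_eq0 -linearB; apply/eqP/fJ; exact: quot_reprK.
have FL : linear F.
  move=> k a b; elim/quot_ind: a => a; elim/quot_ind: b => b.
  by rewrite -(quot_projZ J k a) -(quot_projD J (k *: a) b) !FE linearP.
have FM : {morph F : a b / a ** b}.
  move=> a b; elim/quot_ind: a => a; elim/quot_ind: b => b.
  by rewrite -(quot_projM J a b) !FE homM.
have FS : {morph F : a / star a}.
  by move=> a; elim/quot_ind: a => a; rewrite -(quot_projS J a) !FE homS.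
have [h hE] := mk_starHom FL FM FS; exists h => a.
by rewrite hE FE.
Qed.

End QuotientLift.

Section LeavittFamilies.
Variables (K : fieldType) (theta : involutive_rmorphism K) (E : sepGraph).

(** The relations of [E] are stated in any star-algebra: the universal property
    asks for them in its target, and the arguments on commutators apply to the
    generators of the Leavitt algebra and to their images in the completion. *)
Record leavitt_family (B : starAlgType theta) (p : sg_vertex E -> B)
    (s : sg_edge E -> B) : Prop := LeavittFamily {
  lf_vertex : forall v w, p v ** p w = if v == w then p v else 0;
  lf_vertex_star : forall v, star (p v) = p v;
  lf_rng : forall e, p (sg_rng e) ** s e = s e;
  lf_src : forall e, s e ** p (sg_src e) = s e;
  lf_SCK1 : forall v (X : set (sg_edge E)) e f, sg_part v X -> X e -> X f ->
    star (s e) ** s f = if e == f then p (sg_src e) else 0;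
  lf_SCK2 : forall v (X : set (sg_edge E)), sg_part v X -> finite_set X ->
    p v = \sum_(e \in X) (s e ** star (s e))
}.

Lemma leavitt_lift (B : starAlgType theta) p s : leavitt_family p s ->
  exists f : starHom (leavitt theta E) B,
    (forall v, f (leavitt_vertex theta v) = p v) /\
    (forall e, f (leavitt_edge theta e) = s e).
Proof.
move=> fam.
have [f fE] := free_lift (fun x => match x with inl v => p v | inr e => s e end).
have frel a b : leavitt_rel a b -> f a = f b.
  case=> {a b} [v w|v|e|e|v X e e' EX Xe Xe'|v X EX finX].
  - rewrite homM !fE (lf_vertex fam); case: ifP => _; first by rewrite fE.
    by rewrite linear0.
  - by rewrite homS !fE (lf_vertex_star fam).
  - by rewrite homM !fE (lf_rng fam).
  - by rewrite homM !fE (lf_src fam).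
  - rewrite homM homS !fE (lf_SCK1 fam EX Xe Xe'); case: ifP => _.
      by rewrite fE.
    by rewrite linear0.
  - rewrite fE hom_fsum// (lf_SCK2 fam EX finX).
    by apply: eq_fsbigr => e _; rewrite homM homS fE.
have fJ a : leavittIdeal theta E a -> f a = 0.
  move=> Ja; apply: (Ja [set a | f a = 0]); first exact: hom_kernel_ideal.
  move=> c [[a' [b [ab ->]]]|[_ [a' [b [ab ->]]] <-]] /=.
    by rewrite linearB /= (frel _ _ ab) subrr.
  by rewrite homS linearB /= (frel _ _ ab) subrr star0.
have [h hE] := quot_lift fJ; exists h.
by split=> x; rewrite hE fE.
Qed.

Lemma leavitt_rel_eq (a b : freeStar theta (sg_vertex E + sg_edge E)) :
  leavitt_rel a b -> quot_proj (leavittIdeal theta E) a = quot_proj _ b.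
Proof.
by move=> ab; apply/quot_projP; apply: sub_ideal_gen; left; exists a, b.
Qed.

Lemma quot_proj_starHom (A : starAlgType theta) (J : starIdeal A) :
  exists h : starHom A (quotAlg J), forall a, h a = quot_proj J a.
Proof.
apply: mk_starHom.
- by move=> k a b; rewrite quot_projD quot_projZ.
- by move=> a b; rewrite quot_projM.
- by move=> a; rewrite quot_projS.
Qed.

Lemma leavitt_is_family :
  leavitt_family (@leavitt_vertex _ theta E) (@leavitt_edge _ theta E).
Proof.
have [h hE] := quot_proj_starHom (leavittIdeal theta E).
have hrel a b : leavitt_rel a b -> h a = h b.
  by move=> ab; rewrite !hE; exact: leavitt_rel_eq.
rewrite (_ : @leavitt_vertex _ theta E =
  fun v => h (free_gen theta (inl v))); last by apply/funext => v; rewrite hE.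
rewrite (_ : @leavitt_edge _ theta E =
  fun e => h (free_gen theta (inr e))); last by apply/funext => e; rewrite hE.
split.
- move=> v w; rewrite -homM; have /= -> := hrel _ _ (lrel_vertex theta v w).
  by case: ifP; rewrite ?linear0.
- by move=> v; rewrite -homS; have /= <- := hrel _ _ (lrel_vertex_star theta v).
- by move=> e; rewrite -homM; have /= -> := hrel _ _ (lrel_rng theta e).
- by move=> e; rewrite -homM; have /= -> := hrel _ _ (lrel_src theta e).
- move=> v X e e' EX Xe Xe'; rewrite -homS -homM.
  have /= -> := hrel _ _ (lrel_SCK1 theta EX Xe Xe').
  by case: ifP; rewrite ?linear0.
- move=> v X EX finX; have /= -> := hrel _ _ (lrel_SCK2 theta EX finX).
  by rewrite hom_fsum//; apply: eq_fsbigr => e _; rewrite homM homS.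
Qed.

Lemma family_image (A B : starAlgType theta) (f : starHom A B) p s :
  leavitt_family p s -> leavitt_family (f \o p) (f \o s).
Proof.
move=> fam; split=> /=.
- by move=> v w; rewrite -homM (lf_vertex fam); case: ifP; rewrite ?linear0.
- by move=> v; rewrite -homS (lf_vertex_star fam).
- by move=> e; rewrite -homM (lf_rng fam).
- by move=> e; rewrite -homM (lf_src fam).
- move=> v X e e' EX Xe Xe'; rewrite -homS -homM (lf_SCK1 fam EX Xe Xe').
  by case: ifP; rewrite ?linear0.
- move=> v X EX finX; rewrite (lf_SCK2 fam EX finX) hom_fsum//.
  by apply: eq_fsbigr => e _; rewrite homM homS.
Qed.

Lemma leavitt_ind (P : leavitt theta E -> Prop) :
  (forall v, P (leavitt_vertex theta v)) ->
  (forall e, P (leavitt_edge theta e)) -> P 0 ->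
  (forall a b, P a -> P b -> P (a + b)) ->
  (forall k a, P a -> P (k *: a)) ->
  (forall a b, P a -> P b -> P (a ** b)) ->
  (forall a, P a -> P (star a)) -> forall a, P a.
Proof.
move=> Pv Pe P0 PD PZ PM PS.
elim/quot_ind; elim/free_ind.
elim=> [[v|e]||t IHt u IHu|t IHt|k t IHt|t IHt u IHu|t IHt].
- exact: Pv.
- exact: Pe.
- exact: P0.
- by rewrite -free_addE -quot_addE; exact: PD.
- rewrite -free_oppE -quot_oppE; set x := quot_proj _ _.
  have -> : quot_opp x = (-1) *: x by rewrite scaleN1r.
  exact: PZ.
- by rewrite -free_scaleE -quot_scaleE; exact: PZ.
- by rewrite -free_mulE -quot_mulE; exact: PM.
- by rewrite -free_starE -quot_starE; exact: PS.
Qed.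

End LeavittFamilies.

(** * The doubled separated graph *)

Section Doubling.
Variable E : sepGraph.
Local Notation V := (sg_vertex E).
Local Notation D := (sg_edge E).

(** [inl v] and [inr v] are the target and the source copy of the vertex [v]; the
    edge [inl e] is a copy of [e] and [inr v] is the additional edge [h_v]. *)
Definition double_src (x : D + V) : V + V :=
  match x with inl e => inr (sg_src e) | inr v => inr v end.
Definition double_rng (x : D + V) : V + V :=
  match x with inl e => inl (sg_rng e) | inr v => inl v end.
Definition double_part (w : V + V) : set (set (D + V)) :=
  match w with
  | inl v => [set inl @` X | X in sg_part v] `|` [set [set inr v]]
  | inr _ => set0
  end.

Lemma double_partP w : partition (double_part w) id (double_rng @^-1` [set w]).
Proof.
case: w => v; last first.
  split=> //.
  by rewrite /cover bigcup_set0; apply/seteqP; split => // -[e|u].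
have [cov triv ne] := sg_partP v; split => /=.
- apply/seteqP; split=> [x [X [[Y EY <-]|->]]|].
  + move=> [e Ye <-] /=; congr inl.
    have : cover (sg_part v) id e by exists Y.
    by rewrite cov.
  + by move=> ->.
  + move=> [e|u] /= [ev]; last by exists [set inr v]; [right|rewrite /= ev].
    have : (@sg_rng E @^-1` [set v]) e by [].
    rewrite -cov => -[Y EY Ye]; exists (inl @` Y); last by exists e.
    by left; exists Y.
- move=> X Y [[X' EX' <-]|->] [[Y' EY' <-]|->] [z []] //.
  + move=> [e Xe <-] [e' Ye' [ee']]; rewrite ee' in Ye'.
    by rewrite (triv _ _ EX' EY')//; exists e.
  + by move=> [e Xe <-].
  + by move=> -> [].
- move=> X [[Y EY <-]|->]; last by exists (inr v).
  by have [e Ye] := ne _ EY; exists (inl e), e.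
Qed.

Definition doubleGraph : sepGraph := 
  @SepGraph (V + V)%type (D + V)%type double_src double_rng double_part
    double_partP.

(** Both copies of [v] are endpoints of [h_v], also when [v] is isolated in [E]. *)
Lemma double_bipartite : bipartite doubleGraph.
Proof.
exists (range inl), (range inr); split.
- by apply/seteqP; split => // -[v|v] _; [left|right]; exists v.
- by apply/seteqP; split => // x [[v _ <-] []].
- by move=> [e|v]; split; eexists.
- by move=> _ [v _ <-]; exists (inr v).
- by move=> _ [v _ <-]; exists (inr v).
Qed.

Section Families.
Variables (K : fieldType) (theta : involutive_rmorphism K).
Variable A : starAlgType theta.

Section ToMatrices.
Variables (p : V -> A) (s : D -> A).

Definition double_mx_vertex (w : sg_vertex doubleGraph) : mxStar 2 A :=
  match w with inl v => emx (p v) 0 0 | inr v => emx (p v) 1 1 end.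
Definition double_mx_edge (x : sg_edge doubleGraph) : mxStar 2 A :=
  match x with inl e => emx (s e) 0 1 | inr v => emx (p v) 0 1 end.

(** The index [0] stands for target copies and [1] for source copies, so a
    product of two generators vanishes when these do not match; in all other
    cases the relation is that of [p] and [s] in a single entry. *)
Lemma double_mx_family : leavitt_family p s ->
  leavitt_family double_mx_vertex double_mx_edge.
Proof.
move=> fam; have pp v : p v ** p v = p v by rewrite (lf_vertex fam) eqxx.
have ps := lf_vertex_star fam.
split.
- move=> [v|v] [w|w]; rewrite /= emx_mul //= (lf_vertex fam) ?emx0//.
    rewrite (_ : (inl v == inl w :> sg_vertex doubleGraph) = (v == w))//.
    by case: ifP; rewrite ?emx0.
  rewrite (_ : (inr v == inr w :> sg_vertex doubleGraph) = (v == w))//.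
  by case: ifP; rewrite ?emx0.
- by move=> [v|v]; rewrite /= emx_star ps.
- by move=> [e|v]; rewrite /= emx_mul /= ?pp ?(lf_rng fam).
- by move=> [e|v]; rewrite /= emx_mul /= ?pp ?(lf_src fam).
- move=> [v|//] X x y /= [[Y EY <-]|->]; last first.
    by move=> /= -> ->; rewrite eqxx /= emx_star emx_mul /= ps pp.
  move=> [e Ye <-] [e' Ye' <-].
  rewrite /= emx_star emx_mul /= (lf_SCK1 fam EY Ye Ye').
  rewrite (_ : (inl e == inl e' :> sg_edge doubleGraph) = (e == e'))//.
  by case: ifP; rewrite ?emx0.
- move=> [v|//] X /= [[Y EY <-]|->] finX.
    have inlI : set_inj Y (@inl D V) by move=> ? ? _ _ [].
    have finY : finite_set Y.
      by rewrite -(eq_finite_set (inj_card_eq inlI)).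
    rewrite (lf_SCK2 fam EY finY) fsbig_image//.
    have [c cE] := cornerP A (0 : 'I_2).
    rewrite -cE hom_fsum//; apply: eq_fsbigr => e _.
    by rewrite cE /= emx_star emx_mul.
  by rewrite fsbig_set1 /= emx_star emx_mul /= ps pp.
Qed.

End ToMatrices.
End Families.
End Doubling.

Section Compression.
Variables (K : fieldType) (theta : involutive_rmorphism K) (E : sepGraph).
Variables (B : starAlgType theta).
Variables (p : sg_vertex (doubleGraph E) -> B) (s : sg_edge (doubleGraph E) -> B).
Hypothesis fam : leavitt_family p s.
Local Notation v0 v := (p (inl v)).
Local Notation v1 v := (p (inr v)).
Local Notation h v := (s (inr v)).

Lemma double_h_rng v : v0 v ** h v = h v.
Proof. exact: (lf_rng fam (inr v)). Qed.
Lemma double_h_src v : h v ** v1 v = h v.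
Proof. exact: (lf_src fam (inr v)). Qed.
Lemma double_h_SCK1 v : star (h v) ** h v = v1 v.
Proof.
have part : sg_part (inl v : sg_vertex (doubleGraph E)) [set inr v] by right.
by rewrite (lf_SCK1 fam part erefl erefl) eqxx.
Qed.
Lemma double_h_SCK2 v : h v ** star (h v) = v0 v.
Proof.
have part : sg_part (inl v : sg_vertex (doubleGraph E)) [set inr v] by right.
by rewrite (lf_SCK2 fam part (finite_set1 _)) fsbig_set1.
Qed.
Lemma double_hs_rng v : v1 v ** star (h v) = star (h v).
Proof. by rewrite -{1}(lf_vertex_star fam) -starM double_h_src. Qed.
Lemma double_hs_src v : star (h v) ** v0 v = star (h v).
Proof. by rewrite -{1}(lf_vertex_star fam) -starM double_h_rng. Qed.

(** The copy of [E] in the corner of the target vertices: an edge of the doubled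
    graph ends in this corner, and [h^*] brings its origin back there. *)
Definition compress_vertex (v : sg_vertex E) : B := v0 v.
Definition compress_edge (e : sg_edge E) : B := s (inl e) ** star (h (sg_src e)).

Lemma double_edge_src e : s (inl e) ** v1 (sg_src e) = s (inl e).
Proof. exact: (lf_src fam (inl e)). Qed.

Lemma compress_family : leavitt_family compress_vertex compress_edge.
Proof.
rewrite /compress_vertex /compress_edge; split.
- by move=> v w; exact: (lf_vertex fam).
- by move=> v; exact: (lf_vertex_star fam).
- by move=> e; rewrite amulA; congr (_ ** _); exact: (lf_rng fam (inl e)).
- by move=> e; rewrite -amulA double_hs_src.
- move=> v X e f EX Xe Xf.
  have EX' : sg_part (inl v : sg_vertex (doubleGraph E)) (inl @` X) by left; exists X.
  rewrite starM starK -amulA (amulA (star _) (s (inl f))).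
  rewrite (lf_SCK1 fam EX'); [|by exists e|by exists f].
  rewrite (_ : (inl e == inl f :> sg_edge (doubleGraph E)) = (e == f))//.
  have [<-|_] := eqVneq e f; last by rewrite amul0l amul0r.
  by rewrite /= double_hs_rng double_h_SCK2.
- move=> v X EX finX.
  have EX' : sg_part (inl v : sg_vertex (doubleGraph E)) (inl @` X) by left; exists X.
  rewrite (lf_SCK2 fam EX' (finite_image _ finX)).
  rewrite fsbig_image//; last by move=> ? ? _ _ [].
  apply: eq_fsbigr => e _.
  rewrite starM starK -amulA (amulA (star _) (h _)) double_h_SCK1 amulA.
  by rewrite double_edge_src.
Qed.

Section PartialSums.
Variable F : seq (sg_vertex E).

(** [transfer 0] and [transfer 1] are finite pieces of the multipliers that map
    the corner of the target vertices onto itself and onto the corner of the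
    source vertices. *)
Definition corner_sum : B := \sum_(v <- undup F) v0 v.
Definition shift_sum : B := \sum_(v <- undup F) star (h v).
Definition transfer (i : 'I_2) : B := if i == 0 then corner_sum else shift_sum.

Lemma orthogonal_sum_mul (I : eqType) (r : seq I) (x y : I -> B) :
  uniq r -> (forall i j, i != j -> x i ** y j = 0) ->
  (\sum_(i <- r) x i) ** (\sum_(i <- r) y i) = \sum_(i <- r) x i ** y i.
Proof.
move=> ur xy; rewrite amul_suml; apply: eq_big_seq => i ir.
rewrite amul_sumr (bigD1_seq i)//= big1 ?addr0// => j ji.
by rewrite xy// eq_sym.
Qed.

Lemma double_v0_hs v w : v0 v ** star (h w) = 0.
Proof. by rewrite -double_hs_rng amulA (lf_vertex fam) amul0l. Qed.

Lemma transfer_ortho i j : star (transfer i) ** transfer j = if i == j then transfer 0 else 0.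
Proof.
have cs : star corner_sum = corner_sum.
  by rewrite star_sum; apply: eq_bigr => v _; rewrite (lf_vertex_star fam).
have ch : corner_sum ** shift_sum = 0.
  rewrite amul_suml big1// => v _; rewrite amul_sumr big1// => w _.
  exact: double_v0_hs.
have uF := undup_uniq F.
rewrite /transfer /=; case: ifP => i0; case: ifP => j0.
- rewrite (eqP i0) (eqP j0) eqxx cs orthogonal_sum_mul//.
    by apply: eq_bigr => v _; rewrite (lf_vertex fam) eqxx.
  move=> v w vw; rewrite (lf_vertex fam).
  by rewrite (_ : (inl v == inl w :> sg_vertex (doubleGraph E)) = (v == w))// (negbTE vw).
- by rewrite cs ch (eqP i0) eq_sym j0.
- by rewrite -cs -starM ch star0 (eqP j0) i0.
- have -> : i == j by move: i j i0 j0 => [[|[]]// ?] [[|[]]// ?].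
  rewrite star_sum orthogonal_sum_mul//.
    by apply: eq_bigr => v _; rewrite starK double_h_SCK2.
  move=> v w vw; rewrite starK -double_h_src -double_hs_rng -amulA (amulA (v1 v)).
  rewrite (lf_vertex fam).
  rewrite (_ : (inr v == inr w :> sg_vertex (doubleGraph E)) = (v == w))// (negbTE vw).
  by rewrite amul0l amul0r.
Qed.

Lemma corner_sum_v0 v : v \in F -> corner_sum ** v0 v = v0 v.
Proof.
move=> vF; rewrite amul_suml (bigD1_seq v) ?mem_undup ?undup_uniq//=.
rewrite (lf_vertex fam) eqxx big1 ?addr0// => w wv; rewrite (lf_vertex fam).
by rewrite (_ : (inl w == inl v :> sg_vertex (doubleGraph E)) = (w == v))// (negbTE wv).
Qed.

Lemma shift_sum_v0 v : v \in F -> shift_sum ** v0 v = star (h v).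
Proof.
move=> vF; rewrite amul_suml (bigD1_seq v) ?mem_undup ?undup_uniq//=.
rewrite double_hs_src big1 ?addr0// => w wv; rewrite -double_hs_src -amulA.
rewrite (lf_vertex fam).
rewrite (_ : (inl w == inl v :> sg_vertex (doubleGraph E)) = (w == v))// (negbTE wv).
by rewrite amul0r.
Qed.

End PartialSums.
End Compression.

Section LocalUnits.
Variables (K : fieldType) (theta : involutive_rmorphism K) (E : sepGraph).
Local Notation p := (@leavitt_vertex _ theta E).

Definition vertex_sum (F : seq (sg_vertex E)) : leavitt theta E :=
  \sum_(v <- undup F) p v.

Lemma vertex_sum_star F : star (vertex_sum F) = vertex_sum F.
Proof.
rewrite star_sum; apply: eq_bigr => v _.
exact: (lf_vertex_star (leavitt_is_family theta E)).
Qed.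

Lemma vertex_sum_mull (F : seq (sg_vertex E)) v : v \in F ->
  vertex_sum F ** p v = p v.
Proof.
have fam := leavitt_is_family theta E.
move=> vF; rewrite amul_suml (bigD1_seq v) ?mem_undup ?undup_uniq//=.
rewrite (lf_vertex fam) eqxx big1 ?addr0// => w wv.
by rewrite (lf_vertex fam) (negbTE wv).
Qed.

Lemma vertex_sum_mulr (F : seq (sg_vertex E)) v : v \in F ->
  p v ** vertex_sum F = p v.
Proof.
have ps := lf_vertex_star (leavitt_is_family theta E).
by move=> vF; rewrite -vertex_sum_star -{1}ps -starM vertex_sum_mull.
Qed.

(** All larger finite sets are required to work as well, so that finitely many
    elements have a common local unit. *)
Lemma leavitt_local_unit a : exists F : seq (sg_vertex E),
  forall F' : seq (sg_vertex E), {subset F <= F'} ->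
    vertex_sum F' ** a = a /\ a ** vertex_sum F' = a.
Proof.
have fam := leavitt_is_family theta E.
elim/leavitt_ind: a.
- move=> v; exists [:: v] => F' FF'.
  have vF : v \in F' by apply: FF'; rewrite inE.
  by split; [exact: vertex_sum_mull|exact: vertex_sum_mulr].
- move=> e; exists [:: sg_rng e; sg_src e] => F' FF'.
  have rF : sg_rng e \in F' by apply: FF'; rewrite inE eqxx.
  have sF : sg_src e \in F' by apply: FF'; rewrite !inE eqxx orbT.
  split.
    by rewrite -{1}(lf_rng fam) amulA vertex_sum_mull// (lf_rng fam).
  by rewrite -{1}(lf_src fam) -amulA vertex_sum_mulr// (lf_src fam).
- by exists [::] => F' _; rewrite amul0l amul0r.
- move=> a b [F1 h1] [F2 h2]; exists (F1 ++ F2) => F' FF'.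
  have [| a1 a2] := h1 F'; first by move=> v v1; apply: FF'; rewrite mem_cat v1.
  have [| b1 b2] := h2 F'.
    by move=> v v2; apply: FF'; rewrite mem_cat v2 orbT.
  by rewrite amulDl amulDr a1 a2 b1 b2.
- move=> k a [F h]; exists F => F' /h[h1 h2].
  by rewrite amulZl amulZr h1 h2.
- move=> a b [F1 h1] [F2 h2]; exists (F1 ++ F2) => F' FF'.
  have [| a1 a2] := h1 F'; first by move=> v v1; apply: FF'; rewrite mem_cat v1.
  have [| b1 b2] := h2 F'.
    by move=> v v2; apply: FF'; rewrite mem_cat v2 orbT.
  by rewrite amulA a1 -amulA b2.
- move=> a [F h]; exists F => F' /h[h1 h2].
  by rewrite -vertex_sum_star -!starM h1 h2.
Qed.

End LocalUnits.

Lemma I2_ind (P : 'I_2 -> Prop) : P 0 -> P 1 -> forall i, P i.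
Proof.
move=> P0 P1 [[|[|//]] h].
  by rewrite (_ : Ordinal h = 0)//; exact: val_inj.
by rewrite (_ : Ordinal h = 1)//; exact: val_inj.
Qed.

(** * The Leavitt algebra of the doubled graph *)

Section LeavittDouble.
Variables (K : fieldType) (theta : involutive_rmorphism K) (E : sepGraph).
Local Notation A := (leavitt theta E).
Local Notation B := (leavitt theta (doubleGraph E)).
Local Notation pA := (@leavitt_vertex _ theta E).
Local Notation sA := (@leavitt_edge _ theta E).
Local Notation pB := (@leavitt_vertex _ theta (doubleGraph E)).
Local Notation sB := (@leavitt_edge _ theta (doubleGraph E)).

Variables (f : starHom B (mxStar 2 A)) (phi : starHom A B).
Hypothesis fv : forall w, f (pB w) = double_mx_vertex pA w.
Hypothesis fe : forall x, f (sB x) = double_mx_edge pA sA x.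
Hypothesis phiv : forall v, phi (pA v) = compress_vertex pB v.
Hypothesis phie : forall e, phi (sA e) = compress_edge sB e.

Let famA := leavitt_is_family theta E.
Let famB := leavitt_is_family theta (doubleGraph E).

(** The coefficients [a] for which every [emx a i j] is attained form a
    star-subalgebra, and it contains the generators: [v E_01] is the image of
    [h_v], and [e E_ij] is [v E_i0] times [e E_01] times [w E_1j] for the end [v]
    and the origin [w] of [e]. *)
Lemma double_surj x : exists y, f y = x.
Proof.
suff emx_im a : forall i j, exists y, f y = emx a i j.
  have [g gE] := choice (fun ij : 'I_2 * 'I_2 => emx_im (x ij.1 ij.2) ij.1 ij.2).
  exists (\sum_i \sum_j g (i, j)); rewrite [RHS]mx_emx_sum linear_sum/=.
  by apply: eq_bigr => i _; rewrite linear_sum/=; apply: eq_bigr => j _.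
have emx_im_mul a' b i j k : (exists y, f y = emx a' i j) ->
    (exists y, f y = emx b j k) -> exists y, f y = emx (a' ** b) i k.
  by move=> [y fy] [z fz]; exists (y ** z); rewrite homM fy fz emx_mul eqxx.
have emx_im_star a' i j : (exists y, f y = emx a' i j) ->
    exists y, f y = emx (star a') j i.
  by move=> [y fy]; exists (star y); rewrite homS fy emx_star.
have emx_v v k l : exists y, f y = emx (pA v) k l.
  have h01 : exists y, f y = emx (pA v) 0 1.
    by exists (sB (inr v)); rewrite fe.
  have h10 : exists y, f y = emx (pA v) 1 0.
    by rewrite -(lf_vertex_star famA); exact: emx_im_star.
  have h00 : exists y, f y = emx (pA v) 0 0 by exists (pB (inl v)); rewrite fv.
  have h11 : exists y, f y = emx (pA v) 1 1 by exists (pB (inr v)); rewrite fv.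
  by move: k l; elim/I2_ind; elim/I2_ind.
elim/leavitt_ind: a.
- by move=> v; exact: emx_v.
- move=> e i j.
  rewrite -(lf_src famA) -(lf_rng famA).
  apply: (emx_im_mul _ _ _ 1); last exact: emx_v.
  apply: (emx_im_mul _ _ _ 0); first exact: emx_v.
  by exists (sB (inl e)); rewrite fe.
- by move=> i j; exists 0; rewrite emx0 linear0.
- move=> a b ha hb i j; have [y fy] := ha i j; have [z fz] := hb i j.
  by exists (y + z); rewrite linearD emxD fy fz.
- move=> k a ha i j; have [y fy] := ha i j.
  by exists (k *: y); rewrite linearZ emxZ/= fy.
- move=> a b ha hb i j; exact: emx_im_mul (ha i 0) (hb 0 j).
- move=> a ha i j; exact: emx_im_star.
Qed.

(** The candidate for the inverse: it reads a matrix as an element of the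
    doubled algebra by moving each entry from the corner to its place.  It agrees
    with the inverse on matrices whose entries have [F] as a local unit. *)
Definition reassemble F (x : mxStar 2 A) : B :=
  \sum_i \sum_j transfer pB sB F i ** phi (x i j) ** star (transfer pB sB F j).

Lemma reassembleD F (x y : mxStar 2 A) :
  reassemble F (x + y) = reassemble F x + reassemble F y.
Proof.
rewrite /reassemble -big_split; apply: eq_bigr => i _ /=.
rewrite -big_split; apply: eq_bigr => j _ /=.
by rewrite mx_addE linearD amulDr amulDl.
Qed.

Lemma reassembleZ F (k : K) x : reassemble F (k *: x) = k *: reassemble F x.
Proof.
rewrite /reassemble scaler_sumr; apply: eq_bigr => i _ /=.
rewrite scaler_sumr; apply: eq_bigr => j _ /=.
by rewrite mx_scaleE linearZ/= amulZr amulZl.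
Qed.

Lemma reassemble_star F x : reassemble F (star x) = star (reassemble F x).
Proof.
rewrite /reassemble exchange_big star_sum; apply: eq_bigr => i _ /=.
rewrite star_sum; apply: eq_bigr => j _ /=.
by rewrite mx_starE homS !starM starK amulA.
Qed.

(** The [transfer i] are partial isometries with common initial projection
    [transfer 0] and orthogonal ranges, so all cross terms vanish and what
    remains is [transfer 0] between two entries, which the hypothesis absorbs. *)
Lemma reassembleM F (x y : mxStar 2 A) :
  (forall i j, phi (x i j) ** transfer pB sB F 0 = phi (x i j)) ->
  reassemble F (x ** y) = reassemble F x ** reassemble F y.
Proof.
move=> xF; rewrite /reassemble amul_suml; apply: eq_bigr => i _.
rewrite amul_suml.
transitivity (\sum_j \sum_l
    transfer pB sB F i ** phi (x i j) ** phi (y j l) ** star (transfer pB sB F l)).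
  rewrite exchange_big; apply: eq_bigr => l _ /=.
  rewrite mx_mulE linear_sum/= amul_sumr amul_suml; apply: eq_bigr => j _.
  by rewrite homM !amulA.
apply: eq_bigr => j _.
rewrite amul_sumr [RHS](bigD1 j)//= [X in _ = _ + X]big1 ?addr0 => [|k kj].
  rewrite amul_sumr; apply: eq_bigr => l _.
  have TT := transfer_ortho famB F j j; rewrite eqxx in TT.
  rewrite -[RHS]amulA [X in _ = _ ** X]amulA [X in _ = _ ** (X ** _)]amulA TT.
  by rewrite !amulA -(amulA _ (phi _) (transfer _ _ _ _)) xF.
rewrite amul_sumr big1// => l _.
have TT := transfer_ortho famB F j k; rewrite eq_sym (negbTE kj) in TT.
rewrite -[LHS]amulA [X in _ ** X = _]amulA [X in _ ** (X ** _) = _]amulA TT.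
by rewrite !(amul0l, amul0r).
Qed.

Lemma reassemble_emx F a i j :
  reassemble F (emx a i j) = transfer pB sB F i ** phi a ** star (transfer pB sB F j).
Proof.
rewrite /reassemble (bigD1 i)//= (bigD1 j)//= emxE !eqxx/=.
rewrite !big1 ?addr0// => [k ki|k kj].
  by rewrite big1// => l _; rewrite emxE (negbTE ki) linear0 amul0r amul0l.
by rewrite emxE (negbTE kj) andbF linear0 amul0r amul0l.
Qed.

Lemma phi_vertex_sum F : phi (vertex_sum theta F) = transfer pB sB F 0.
Proof.
by rewrite linear_sum /transfer eqxx; apply: eq_bigr => v _ /=; rewrite phiv.
Qed.

(** By induction on [y].  In the case of a product, [F] has to be large enough
    for both factors and to contain a local unit for each of the four entries of
    the left one. *)
Lemma reassembleK y : exists F : seq (sg_vertex E),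
  forall F' : seq (sg_vertex E), {subset F <= F'} -> reassemble F' (f y) = y.
Proof.
have v00 v : pB (inl v) ** pB (inl v) = pB (inl v) by rewrite (lf_vertex famB) eqxx.
have vs v : star (pB (inl v)) = pB (inl v) by rewrite (lf_vertex_star famB).
have T0v F v : v \in F -> transfer pB sB F 0 ** pB (inl v) = pB (inl v).
  by move=> vF; exact: (corner_sum_v0 famB vF).
have T1v F v : v \in F -> transfer pB sB F 1 ** pB (inl v) = star (sB (inr v)).
  by move=> vF; exact: (shift_sum_v0 famB vF).
have T0v' F v : v \in F -> pB (inl v) ** star (transfer pB sB F 0) = pB (inl v).
  by move=> vF; rewrite -{1}vs -starM T0v.
have T1v' F v : v \in F -> pB (inl v) ** star (transfer pB sB F 1) = sB (inr v).
  by move=> vF; rewrite -{1}vs -starM T1v// starK.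
elim/leavitt_ind: y.
- move=> [v|v]; exists [:: v] => F' FF'.
    have vF : v \in F' by apply: FF'; rewrite inE.
    by rewrite fv reassemble_emx phiv /compress_vertex T0v// T0v'.
  have vF : v \in F' by apply: FF'; rewrite inE.
  rewrite fv reassemble_emx phiv /compress_vertex -v00 amulA T1v// -amulA T1v'//.
  by rewrite (double_h_SCK1 famB).
- move=> [e|v].
    exists [:: sg_rng e; sg_src e] => F' FF'.
    have rF : sg_rng e \in F' by apply: FF'; rewrite inE eqxx.
    have sF : sg_src e \in F' by apply: FF'; rewrite !inE eqxx orbT.
    rewrite fe reassemble_emx phie /compress_edge.
    rewrite -{1}(lf_rng famB (inl e)) !amulA T0v// (lf_rng famB (inl e)).
    rewrite -(double_hs_src famB) -!amulA T1v'// (double_h_SCK1 famB).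
    exact: (double_edge_src famB).
  exists [:: v] => F' FF'; have vF : v \in F' by apply: FF'; rewrite inE.
  by rewrite fe reassemble_emx phiv /compress_vertex T0v// T1v'.
- by exists [::] => F' _; rewrite linear0 -(scale0r (0 : mxStar 2 A)) reassembleZ scale0r.
- move=> a b [F1 h1] [F2 h2]; exists (F1 ++ F2) => F' FF'.
  rewrite linearD reassembleD h1 ?h2// => v vF; apply: FF'.
    by rewrite mem_cat vF orbT.
  by rewrite mem_cat vF.
- by move=> k a [F h]; exists F => F' /h{}h; rewrite linearZ/= reassembleZ h.
- move=> a b [F1 h1] [F2 h2].
  have [G GP] := choice (fun ij : 'I_2 * 'I_2 =>
    leavitt_local_unit (f a ij.1 ij.2)).
  exists (F1 ++ F2 ++ G (0, 0) ++ G (0, 1) ++ G (1, 0) ++ G (1, 1)) => F' FF'.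
  rewrite homM reassembleM.
    rewrite h1 ?h2// => v vF; apply: FF'; rewrite !mem_cat vF ?orbT//.
  move=> i j; rewrite -phi_vertex_sum -homM; congr (phi _).
  have [] // := GP (i, j) F' _ => v vG; apply: FF'; rewrite !mem_cat.
  by move: i j vG; elim/I2_ind; elim/I2_ind => ->; rewrite !orbT.
- by move=> a [F h]; exists F => F' /h{}h; rewrite homS reassemble_star h.
Qed.

Lemma double_inj : injective f.
Proof.
move=> y z fyz.
have [F1 h1] := reassembleK y; have [F2 h2] := reassembleK z.
rewrite -(h1 (F1 ++ F2)) => [|v vF]; last by rewrite mem_cat vF.
by rewrite fyz h2// => v vF; rewrite mem_cat vF orbT.
Qed.

Lemma double_bij : bijective f.
Proof.
have [g gK] := choice double_surj.
by exists g => // y; apply: double_inj; rewrite gK.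
Qed.

End LeavittDouble.

Lemma leavitt_double (K : fieldType) (theta : involutive_rmorphism K)
    (E : sepGraph) :
  exists f : starHom (leavitt theta (doubleGraph E)) (mxStar 2 (leavitt theta E)),
  [/\ bijective f,
      forall w, f (leavitt_vertex theta w) =
        double_mx_vertex (@leavitt_vertex _ theta E) w &
      forall x, f (leavitt_edge theta x) =
        double_mx_edge (@leavitt_vertex _ theta E) (@leavitt_edge _ theta E) x].
Proof.
have [f [fv fe]] := leavitt_lift (double_mx_family (leavitt_is_family theta E)).
have [phi [phiv phie]] :=
  leavitt_lift (compress_family (leavitt_is_family theta (doubleGraph E))).
by exists f; split => //; exact: (double_bij fv fe phiv phie).
Qed.

(** * Commutators of final projections *)

Section Semigroup.
Variables (K : fieldType) (theta : involutive_rmorphism K) (E : sepGraph).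
Variables (A : starAlgType theta) (p : sg_vertex E -> A) (s : sg_edge E -> A).
Hypothesis fam : leavitt_family p s.

Let pp v : p v ** p v = p v.
Proof. by rewrite (lf_vertex fam) eqxx. Qed.
Let ps v : star (p v) = p v.
Proof. exact: (lf_vertex_star fam). Qed.

Lemma star_semigroup_star u : star_semigroup s u -> star_semigroup s (star u).
Proof.
elim=> [x|x|a b _ IHa _ IHb]; first exact: ssg_star.
  by rewrite starK; exact: ssg_gen.
by rewrite starM; exact: ssg_mul.
Qed.

Lemma star_semigroup_range u : star_semigroup s u -> exists v, p v ** u = u.
Proof.
elim=> [x|x|a b _ [v va] _ _].
- by exists (sg_rng x); exact: (lf_rng fam).
- by exists (sg_src x); rewrite -{1}ps -starM (lf_src fam).
- by exists v; rewrite amulA va.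
Qed.

Lemma star_semigroup_vertexl v u : star_semigroup s u ->
  p v ** u = u \/ p v ** u = 0.
Proof.
move=> /star_semigroup_range[w wu]; rewrite -{1 3}wu amulA (lf_vertex fam).
case: ifP => vw; last by right; rewrite amul0l.
by left; rewrite (eqP vw) wu.
Qed.

Lemma star_semigroup_vertexr v u : star_semigroup s u ->
  u ** p v = u \/ u ** p v = 0.
Proof.
move=> /star_semigroup_star /(star_semigroup_vertexl v)[] h; [left|right].
  by rewrite -{1}(starK u) -ps -starM h starK.
by rewrite -(starK u) -ps -starM h star0.
Qed.

Lemma final_proj_vertex v : final_proj (p v) = p v.
Proof. by rewrite /final_proj ps pp. Qed.

Lemma final_proj_vertex_comm v u : star_semigroup s u ->
  p v ** final_proj u = final_proj u ** p v.
Proof.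
move=> su; have e : star u ** p v = star (p v ** u) by rewrite starM ps.
rewrite /final_proj amulA -[RHS]amulA e.
by have [->|->] := star_semigroup_vertexl v su; rewrite ?star0 ?amul0l ?amul0r.
Qed.

(** The image of [h_v] has the vertex [v] as an entry, which need not be a
    product of edges, and products of matrix units may vanish; both have to be
    allowed. *)
Definition extended_semigroup u : Prop :=
  [\/ star_semigroup s u, exists v, u = p v | u = 0].

Lemma extended_semigroup_mul u w :
  extended_semigroup u -> extended_semigroup w -> extended_semigroup (u ** w).
Proof.
move=> Wu Ww; case: Wu => [su|[v ->]|->]; case: Ww => [sw|[v' ->]|->];
  rewrite ?amul0l ?amul0r; try by constructor 3.
- by constructor 1; exact: ssg_mul.
- have [->|->] := star_semigroup_vertexr v' su; [by constructor 1|by constructor 3].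
- have [->|->] := star_semigroup_vertexl v sw; [by constructor 1|by constructor 3].
- rewrite (lf_vertex fam); case: ifP => _; last by constructor 3.
  by constructor 2; exists v.
Qed.

Lemma extended_semigroup_star u :
  extended_semigroup u -> extended_semigroup (star u).
Proof.
case=> [su|[v ->]|->]; first by constructor 1; exact: star_semigroup_star.
  by constructor 2; exists v.
by constructor 3; rewrite star0.
Qed.

(** Multiplication by a vertex fixes or kills an element of the semigroup, so
    vertices commute with its final projections and contribute nothing new. *)
Lemma extended_commutator (J : set A) u w : ideal J ->
  final_commutators s `<=` J -> extended_semigroup u -> extended_semigroup w ->
  J (final_proj u ** final_proj w - final_proj w ** final_proj u).
Proof.
move=> iJ sJ.
have fp0 : final_proj (0 : A) = 0 by rewrite /final_proj amul0l.
move=> Wu Ww; case: Wu => [su|[v ->]|->]; case: Ww => [sw|[v' ->]|->];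
  rewrite ?fp0 ?amul0l ?amul0r ?subrr; try exact: ideal0.
- by apply: sJ; exists u, w.
- by rewrite final_proj_vertex final_proj_vertex_comm// subrr; exact: ideal0.
- by rewrite final_proj_vertex final_proj_vertex_comm// subrr; exact: ideal0.
- rewrite !final_proj_vertex !(lf_vertex fam) eq_sym.
  by have [->|_] := eqVneq v' v; rewrite subrr; exact: ideal0.
Qed.

(** A commutator of projections below two distinct vertices vanishes because
    these are orthogonal; otherwise the common vertex is a local unit. *)
Lemma final_commutators_corner c : final_commutators s c ->
  c = 0 \/ exists v, p v ** c = c /\ c ** p v = c.
Proof.
move=> [u [w [su sw ->]]].
have [v vu] := star_semigroup_range su; have [v' vw] := star_semigroup_range sw.
have pu : p v ** final_proj u = final_proj u by rewrite /final_proj amulA vu.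
have pw : p v' ** final_proj w = final_proj w by rewrite /final_proj amulA vw.
have up : final_proj u ** p v = final_proj u by rewrite -final_proj_vertex_comm.
have wp : final_proj w ** p v' = final_proj w by rewrite -final_proj_vertex_comm.
move: (final_proj u) (final_proj w) pu pw up wp => a b pu pw up wp.
have [vv|vv] := eqVneq v v'.
  right; exists v; rewrite -vv in pw wp.
  by rewrite amulBr amulBl !amulA pu pw -!amulA up wp.
have ab0 : a ** b = 0.
  by rewrite -up -pw -amulA (amulA (p v)) (lf_vertex fam) (negbTE vv) amul0l amul0r.
have ba0 : b ** a = 0.
  rewrite -wp -pu -amulA (amulA (p v')) (lf_vertex fam) eq_sym (negbTE vv).
  by rewrite amul0l amul0r.
by left; rewrite ab0 ba0 subrr.
Qed.

End Semigroup.

Section CommutatorIdeals.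
Variables (K : fieldType) (theta : involutive_rmorphism K) (E : sepGraph).
Variables (A' A : starAlgType theta) (f : starHom A' (mxStar 2 A)).
Variables (p : sg_vertex E -> A) (s : sg_edge E -> A).
Hypothesis fam : leavitt_family p s.
Variable s' : sg_edge (doubleGraph E) -> A'.
Hypothesis fs : forall x, f (s' x) = double_mx_edge p s x.
Variable g : mxStar 2 A -> A'.
Hypotheses (fK : cancel f g) (gK : cancel g f).

Let ps v : star (p v) = p v.
Proof. exact: (lf_vertex_star fam). Qed.

Lemma double_semigroup_image u : star_semigroup s' u ->
  exists i j w, extended_semigroup p s w /\ f u = emx w i j.
Proof.
have gen x : exists i j w, extended_semigroup p s w /\ f (s' x) = emx w i j.
  rewrite fs; case: x => [e|v]; exists 0, 1.
    by exists (s e); split => //; constructor 1; exact: ssg_gen.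
  by exists (p v); split => //; constructor 2; exists v.
elim=> [x|x|a b _ [i [j [w [Ww fa]]]] _ [k [l [w' [Ww' fb]]]]].
- exact: gen.
- have [i [j [w [Ww fx]]]] := gen x; exists j, i, (star w).
  by rewrite homS fx emx_star; split => //; exact: extended_semigroup_star.
- rewrite homM fa fb emx_mul; case: ifP => _.
    by exists i, l, (w ** w'); split => //; exact: extended_semigroup_mul.
  by exists 0, 0, 0; rewrite emx0; split => //; constructor 3.
Qed.

Lemma double_commutators_entries (J : set A) : ideal J ->
  final_commutators s `<=` J ->
  final_commutators s' `<=` [set x | forall i j, J (f x i j)].
Proof.
move=> iJ sJ c [u [w [/double_semigroup_image[i [j [a [Wa fu]]]]]]].
move=> /double_semigroup_image[k [l [b [Wb fw]]]] -> m n.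
rewrite linearB !homM !homS fu fw /= !emx_star !emx_mul !eqxx !emx_mul.
rewrite (eq_sym k); case: ifP => [/eqP <-|_]; last first.
  by rewrite subrr mx_zeroE; exact: ideal0.
rewrite -emxB emxE; case: ifP => _; last exact: ideal0.
exact: (extended_commutator fam).
Qed.

(** An edge [e] is moved into the corner as the product of its copy with the
    adjoint of [h]. *)
Lemma double_semigroup_lift u : star_semigroup s u ->
  exists2 u', star_semigroup s' u' & f u' = emx u 0 0.
Proof.
have gen x : exists2 u', star_semigroup s' u' & f u' = emx (s x) 0 0.
  exists (s' (inl x) ** star (s' (inr (sg_src x)))).
    by apply: ssg_mul; [exact: ssg_gen|exact: ssg_star].
  by rewrite homM homS !fs /= emx_star emx_mul eqxx ps (lf_src fam).
elim=> [x|x|a b _ [a' sa' fa] _ [b' sb' fb]].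
- exact: gen.
- have [u' su' fu] := gen x; exists (star u'); first exact: star_semigroup_star.
  by rewrite homS fu emx_star.
- by exists (a' ** b'); [exact: ssg_mul|rewrite homM fa fb emx_mul].
Qed.

(** If [v c = c = c v], then [c E_ij] is the product of [v E_i0], [c E_00] and
    [v E_0j], where [c E_00] is the image of a commutator. *)
Lemma double_commutators_units (J' : set A') : ideal J' ->
  final_commutators s' `<=` J' ->
  final_commutators s `<=` [set c | forall i j, J' (g (emx c i j))].
Proof.
move=> iJ sJ c Cc i j.
have [c' Cc' fc] : exists2 c', J' c' & f c' = emx c 0 0.
  have [u [w [su sw ->]]] := Cc.
  have [u' su' fu] := double_semigroup_lift su.
  have [w' sw' fw] := double_semigroup_lift sw.
  exists (final_proj u' ** final_proj w' - final_proj w' ** final_proj u').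
    by apply: sJ; exists u', w'.
  by rewrite linearB !homM !homS fu fw /= !emx_star !emx_mul emxB.
have [->|[v [vc cv]]] := final_commutators_corner fam Cc.
  by rewrite emx0 -[0](linear0 f) fK; exact: ideal0.
have -> : g (emx c i j) = g (emx (p v) i 0) ** c' ** g (emx (p v) 0 j).
  by apply: (can_inj fK); rewrite !homM !gK fc emx_mul /= emx_mul /= vc cv.
by apply: ideal_amulr => //; exact: ideal_amull.
Qed.

Lemma commutatorIdeal_entries x :
  commutatorIdeal s' x <-> forall i j, commutatorIdeal s (f x i j).
Proof.
have iJ := ideal_genP (final_commutators s).
have iJ' := ideal_genP (final_commutators s').
split=> [Jx|Jx].
  apply: (Jx [set x | forall i j, ideal_gen (final_commutators s) (f x i j)]).
    exact: mx_entries_ideal.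
  by apply: double_commutators_entries => //; exact: sub_ideal_gen.
apply: (mx_units_sum fK gK iJ') => i j; move: i j (Jx i j) => i j Jxij.
have := Jxij _ (mx_units_ideal fK gK iJ'); apply.
by apply: double_commutators_units => //; exact: sub_ideal_gen.
Qed.

End CommutatorIdeals.

(** * Finite sums of Hilbert spaces *)

Section SumSquares.
Variables (R : realType) (n : nat).
Implicit Types a b : 'I_n -> R.

Definition l2norm a : R := Num.sqrt (\sum_i a i ^+ 2).

Lemma sumsq_ge0 a : 0 <= \sum_i a i ^+ 2.
Proof. by apply: sumr_ge0 => i _; exact: sqr_ge0. Qed.

Lemma l2norm_sqr a : l2norm a ^+ 2 = \sum_i a i ^+ 2.
Proof. by rewrite sqr_sqrtr// sumsq_ge0. Qed.

Lemma l2norm_ge0 a : 0 <= l2norm a. Proof. exact: sqrtr_ge0. Qed.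

Lemma l2norm_eq0 a i : l2norm a = 0 -> a i = 0.
Proof.
move=> a0; have /eqP := l2norm_sqr a; rewrite a0 expr0n /= eq_sym.
rewrite psumr_eq0 => [/allP/(_ i)|j _]; last exact: sqr_ge0.
by rewrite mem_index_enum /= sqrf_eq0 => /(_ isT)/eqP.
Qed.

(** Expand the sum of the squares of [B a_i - A b_i], where [A] and [B] are the
    norms of [a] and [b]. *)
Lemma l2norm_cauchy_schwarz a b : \sum_i a i * b i <= l2norm a * l2norm b.
Proof.
have [a0|a0] := eqVneq (l2norm a) 0.
  by rewrite a0 mul0r big1// => i _; rewrite (l2norm_eq0 i a0) mul0r.
have [b0|b0] := eqVneq (l2norm b) 0.
  by rewrite b0 mulr0 big1// => i _; rewrite (l2norm_eq0 i b0) mulr0.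
have ab : 0 < l2norm a * l2norm b.
  by rewrite mulr_gt0// lt_neqAle eq_sym l2norm_ge0 ?a0 ?b0.
have : 0 <= \sum_i (l2norm b * a i - l2norm a * b i) ^+ 2.
  by apply: sumr_ge0 => i _; exact: sqr_ge0.
have -> : \sum_i (l2norm b * a i - l2norm a * b i) ^+ 2 =
    l2norm b ^+ 2 * (\sum_i a i ^+ 2) + l2norm a ^+ 2 * (\sum_i b i ^+ 2)
    - (2 * (l2norm a * l2norm b)) * (\sum_i a i * b i).
  rewrite !mulr_sumr -big_split -sumrB /=; apply: eq_bigr => i _; ring.
rewrite -!l2norm_sqr => h.
rewrite -(ler_pM2l ab) -(ler_pM2l (ltr0Sn R 1)).
move: h; rewrite !expr2; nra.
Qed.

(** Stated for a [c] that is only dominated by [a + b], as are the norms of the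
    coordinates of a sum of two vectors. *)
Lemma l2norm_triangle a b c : (forall i, 0 <= c i <= a i + b i) ->
  l2norm c <= l2norm a + l2norm b.
Proof.
move=> cab; rewrite -ler_sqr ?nnegrE ?addr_ge0 ?l2norm_ge0//.
rewrite l2norm_sqr sqrrD !l2norm_sqr.
apply: (@le_trans _ _ (\sum_i (a i + b i) ^+ 2)).
  apply: ler_sum => i _; have /andP[c0 cl] := cab i.
  by rewrite ler_sqr// nnegrE (le_trans c0).
have -> : \sum_i (a i + b i) ^+ 2 =
    \sum_i a i ^+ 2 + (\sum_i a i * b i) *+ 2 + \sum_i b i ^+ 2.
  rewrite -sumrMnl -!big_split /=; apply: eq_bigr => i _; exact: sqrrD.
by rewrite lerD2r lerD2l lerMn2r l2norm_cauchy_schwarz orbT.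
Qed.

Lemma l2norm_le_sum a : (forall i, 0 <= a i) -> l2norm a <= \sum_i a i.
Proof.
move=> a0; have s0 : 0 <= \sum_i a i by exact: sumr_ge0.
rewrite -ler_sqr ?nnegrE ?l2norm_ge0// l2norm_sqr.
rewrite [leRHS]expr2 mulr_suml; apply: ler_sum => i _.
rewrite expr2 ler_wpM2l// (bigD1 i)//= lerDl sumr_ge0//.
Qed.

Lemma le_l2norm a i : 0 <= a i -> a i <= l2norm a.
Proof.
move=> a0; rewrite -ler_sqr ?nnegrE ?l2norm_ge0// l2norm_sqr (bigD1 i)//= lerDl.
by apply: sumr_ge0 => j _; exact: sqr_ge0.
Qed.

Lemma l2normZ k a : 0 <= k -> l2norm (fun i => k * a i) = k * l2norm a.
Proof.
move=> k0; rewrite /l2norm.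
have -> : \sum_i (k * a i) ^+ 2 = k ^+ 2 * \sum_i a i ^+ 2.
  by rewrite mulr_sumr; apply: eq_bigr => i _; rewrite exprMn.
by rewrite sqrtrM ?sqr_ge0// sqrtr_sqr ger0_norm.
Qed.

End SumSquares.

Lemma lipschitz1_continuous (K : numFieldType) (V W : normedModType K)
  (f : V -> W) : (forall x y, `|f x - f y| <= `|x - y|) -> continuous f.
Proof.
move=> fN x; apply/cvgrPdist_lt => e e0; near=> y.
rewrite (le_lt_trans (fN _ _))//.
Unshelve. all: by end_near. Qed.

Section HilbertSum.
Variables (R : realType) (n : nat) (H : hilbertSpace R).

(** A name of its own, so that it can carry the square norm as its norm. *)
Definition hsum : Type := {ffun 'I_n -> H}.
HB.instance Definition _ := GRing.Lmodule.copy hsum {ffun 'I_n -> H}.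
Implicit Types x y : hsum.

Definition hsum_norm x : R := l2norm (fun i => renorm (x i)).

Fact hsum_normD x y :
  (hsum_norm (x + y))%:C%C <= (hsum_norm x)%:C%C + (hsum_norm y)%:C%C :> R[i].
Proof.
rewrite -rmorphD/= lecR; apply: l2norm_triangle => i.
by rewrite renorm_ge0 ffunE renormD.
Qed.
Fact hsum_normZ (k : R[i]) x :
  (hsum_norm (k *: x))%:C%C = `|k| * (hsum_norm x)%:C%C.
Proof.
rewrite -(Re_normK k) -rmorphM/= /hsum_norm -l2normZ.
  by congr (_%:C)%C; congr l2norm; apply/funext => i; rewrite ffunE renormZ.
by rewrite -ler0c Re_normK.
Qed.
Fact hsum_norm_eq0 x : (hsum_norm x)%:C%C = 0 :> R[i] -> x = 0.
Proof.
move=> /complexI x0; apply/ffunP => i; rewrite ffunE.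
have := @l2norm_eq0 _ _ (fun i => renorm (x i)) i x0 => xi0.
by apply/eqP; rewrite -normr_eq0 -renormE xi0.
Qed.

HB.instance Definition _ := Lmodule_isNormed.Build R[i] hsum
  hsum_normD hsum_normZ hsum_norm_eq0.

Lemma hsum_normE x : `|x| = (hsum_norm x)%:C%C. Proof. by []. Qed.

Lemma hsum_coord_le x i : `|x i| <= `|x|.
Proof.
rewrite hsum_normE -renormE lecR.
exact: (@le_l2norm _ _ (fun i => renorm (x i)) _ (renorm_ge0 _)).
Qed.

Lemma hsum_norm_le_sum x : `|x| <= \sum_i `|x i|.
Proof.
rewrite hsum_normE (eq_bigr (fun i => (renorm (x i))%:C%C)); last first.
  by move=> i _; rewrite renormE.
rewrite -rmorph_sum lecR; apply: l2norm_le_sum => i; exact: renorm_ge0.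
Qed.

Lemma hsum_coord_continuous i : continuous (fun x : hsum => x i).
Proof.
apply: lipschitz1_continuous => x y.
by rewrite (_ : x i - y i = (x - y) i) ?hsum_coord_le// !ffunE.
Qed.

Lemma hsum_cvg (T : Type) (F : set_system T) (f : T -> hsum) (l : hsum) :
  Filter F -> (forall i, (fun t => f t i) @ F --> l i) -> f @ F --> l.
Proof.
move=> FF fl; apply/cvgrPdist_lt => e e0.
have en : 0 < e / n.+1%:R by rewrite divr_gt0// ltr0n.
have : \forall t \near F, forall i, `|l i - f t i| < e / n.+1%:R.
  apply: filter_forall => i; by move/cvgrPdist_lt : (fl i) => /(_ _ en).
apply: filterS => t tl; rewrite (le_lt_trans (hsum_norm_le_sum _))//.
apply: (@le_lt_trans _ _ (\sum_(i < n) e / n.+1%:R)).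
  by apply: ler_sum => i _; rewrite !ffunE ltW// tl.
rewrite sumr_const card_ord -[ltLHS]mulr_natr -mulrA gtr_pMr// mulrC.
by rewrite ltr_pdivrMr ?ltr0n// mul1r ltr_nat.
Qed.

(** Coordinates of a Cauchy filter are Cauchy, and coordinatewise convergence is
    convergence because the norm is at most the sum of those of the coordinates. *)
Lemma hsum_complete (F : set_system hsum) : ProperFilter F -> cauchy F -> cvg F.
Proof.
move=> FF cF.
have cFi i : cvg ((fun x : hsum => x i) @ F).
  apply: cauchy_cvg; apply/cauchy_ballP => e e0.
  have /cauchy_ballP/(_ e e0)[[P Q] [FP FQ] PQ] := cF.
  exists ((fun x : hsum => x i) @` P, (fun x : hsum => x i) @` Q).
    by split; [apply: filterS FP => x Px|apply: filterS FQ => x Qx]; exists x.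
  move=> [_ _] [/= [x Px <-] [y Qy <-]].
  have := PQ (x, y) (conj Px Qy); rewrite -!ball_normE /=.
  apply: le_lt_trans; rewrite (_ : x i - y i = (x - y) i) ?hsum_coord_le//.
  by rewrite !ffunE.
apply/cvg_ex; exists [ffun i => lim ((fun x : hsum => x i) @ F)].
apply: (@hsum_cvg _ F id) => i; rewrite ffunE; exact: cFi.
Qed.

End HilbertSum.

Section HilbertSumStructure.
Variables (R : realType) (n : nat) (H : hilbertSpace R).
Local Notation S := (hsum n H).

HB.instance Definition _ := Uniform_isComplete.Build S (@hsum_complete R n H).

Definition hsum_dot (x y : S) : R[i] := \sum_i hilbert_dot H (x i) (y i).

Fact hsum_dot_bilinear : bilinear_for
  ( *%R : GRing.Scale.law _ _) (complex_conj R \; *%R : GRing.Scale.law _ _) hsum_dot.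
Proof.
split=> [y|x] k u v /=; rewrite /hsum_dot.
  rewrite mulr_sumr -big_split; apply: eq_bigr => i _ /=.
  by rewrite !ffunE linearDl linearZl_LR.
rewrite mulr_sumr -big_split; apply: eq_bigr => i _ /=.
by rewrite !ffunE linearDr linearZr_LR.
Qed.

HB.instance Definition _ := bilinear_isBilinear.Build R[i] S S R[i]
  ( *%R) (complex_conj R \; *%R) hsum_dot hsum_dot_bilinear.

Fact hsum_dot_hermitian x y :
  hsum_dot x y = (-1) ^+ false * complex_conj R (hsum_dot y x).
Proof.
rewrite expr0 mul1r /hsum_dot rmorph_sum; apply: eq_bigr => i _.
by rewrite /= hilbert_dotC.
Qed.
HB.instance Definition _ := isHermitianSesquilinear.Build R[i] S false
  (complex_conj R) hsum_dot hsum_dot_hermitian.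

Lemma hsum_norm_dot x : `|x| ^+ 2 = hsum_dot x x.
Proof.
rewrite hsum_normE -rmorphXn /= l2norm_sqr rmorph_sum.
by apply: eq_bigr => i _; rewrite -hilbert_renorm.
Qed.

Fact hsum_dot_gt0 x : x != 0 -> 0 < hsum_dot x x.
Proof. by move=> x0; rewrite -hsum_norm_dot exprn_gt0// normr_gt0. Qed.
HB.instance Definition _ := isDotProduct.Build R[i] S hsum_dot hsum_dot_gt0.

Definition hilbertSum : hilbertSpace R := @HilbertSpace R S hsum_dot hsum_norm_dot.
End HilbertSumStructure.

(** * Representations of matrix algebras and their norms *)

Section Representations.
Variables (R : realType).

Lemma representation_comp (A B : complexStarAlgType R) (f : starHom A B)
    (H : hilbertSpace R) (pi : representation B H) :
  exists rho : representation A H, forall a x, rho a x = pi (f a) x.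
Proof.
unshelve eexists (@Representation R A H (fun a x => pi (f a) x) _ _ _ _ _ _) => //.
- by move=> a; exact: rep_linear.
- by move=> a; exact: rep_continuous.
- by move=> a b x /=; rewrite linearD repD.
- by move=> k a x /=; rewrite linearZ repZ.
- by move=> a b x /=; rewrite homM repM.
- by move=> a x y /=; rewrite homS rep_star.
Qed.

Lemma cvg_sum_fun (V : normedModType R[i]) (T : Type) (F : set_system T) n
    (f : 'I_n -> T -> V) (l : 'I_n -> V) : Filter F ->
  (forall j, f j @ F --> l j) ->
  (fun t => \sum_j f j t) @ F --> \sum_j l j.
Proof.
move=> FF fl; rewrite (_ : (fun t => _) = \sum_j f j); last first.
  by apply/funext => t; rewrite fct_sumE.
elim/big_rec2: _ => [|j x y _ xy]; first exact: cvg_cst.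
exact: cvgD.
Qed.

Section Amplification.
Variables (n : nat) (A : complexStarAlgType R) (H : hilbertSpace R).
Variable pi : representation A H.
Local Notation S := (hilbertSum n H).

Lemma rep_sum m (F : 'I_m -> A) (x : H) :
  pi (\sum_k F k) x = \sum_k pi (F k) x.
Proof. by elim/big_rec2: _ => [|k y z _ <-]; rewrite ?rep0 ?repD. Qed.

Definition amplification_fun (a : mxStar n A) (x : S) : S :=
  [ffun i => \sum_j pi (a i j) ((x : hsum n H) j)].

(** Matrices over [A] act on columns of vectors of [H]; these representations are
    what makes the norm of a matrix as large as those of its entries. *)
Lemma amplification : exists rho : representation (mxStar n A) S,
  forall a x (i : 'I_n), (rho a x : hsum n H) i =
    \sum_j pi (a i j) ((x : hsum n H) j).
Proof.
unshelve eexists (@Representation R (mxStar n A) S amplification_fun _ _ _ _ _ _).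
- move=> a k x y; apply/ffunP => i; rewrite !ffunE scaler_sumr -big_split /=.
  by apply: eq_bigr => j _; rewrite !ffunE rep_linear.
- move=> a x; apply: hsum_cvg; first exact: nbhs_filter.
  move=> i.
  rewrite (_ : (fun t => _) = fun t : hsum n H => \sum_j pi (a i j) (t j)); last first.
    by apply/funext => t; rewrite ffunE.
  rewrite ffunE; apply: cvg_sum_fun; first exact: nbhs_filter.
  move=> j.
  apply: (@continuous_comp _ _ _ (fun t : hsum n H => t j) (pi (a i j))).
    exact: hsum_coord_continuous.
  exact: rep_continuous.
- move=> a b x; apply/ffunP => i; rewrite !ffunE -big_split /=.
  by apply: eq_bigr => j _; rewrite mx_addE repD.
- move=> k a x; apply/ffunP => i; rewrite !ffunE scaler_sumr.
  by apply: eq_bigr => j _; rewrite mx_scaleE repZ.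
- move=> a b x; apply/ffunP => i; rewrite !ffunE.
  transitivity (\sum_j \sum_k pi (a i k) (pi (b k j) ((x : hsum n H) j))).
    apply: eq_bigr => j _; rewrite mx_mulE rep_sum.
    by apply: eq_bigr => k _; rewrite repM.
  rewrite exchange_big; apply: eq_bigr => k _ /=; rewrite ffunE.
  have L := rep_linear pi (a i k).
  have -> (F : 'I_n -> H) : pi (a i k) (\sum_j F j) = \sum_j pi (a i k) (F j).
    elim/big_rec2: _ => [|j y z _ <-].
      by rewrite -(scale0r (0 : H)) rep_scaler !scale0r.
    by have := L 1 (F j) z; rewrite !scale1r.
  by [].
- move=> a x y; rewrite /= /hsum_dot.
  transitivity (\sum_i \sum_j hilbert_dot H ((x : hsum n H) j)
      (pi (star (a i j)) ((y : hsum n H) i))).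
    apply: eq_bigr => i _; rewrite ffunE linear_sumlz.
    by apply: eq_bigr => j _; rewrite /= rep_star.
  rewrite exchange_big; apply: eq_bigr => j _ /=.
  rewrite ffunE linear_sumr; apply: eq_bigr => i _.
  by rewrite mx_starE.
by move=> a x i; rewrite /= ffunE.
Qed.

End Amplification.
End Representations.

Section NormComparison.
Variable R : realType.

(** With [y = T x] and [z = T^* T x], this bounds [T] by the square root of a
    bound of [T^* T].  It is the Cauchy-Schwarz inequality for [z] and [x], here
    obtained from the positivity of the square of [z / M - M x]. *)
Lemma hilbert_square_bound (H : hilbertSpace R) (x y z : H) (M : R) : 0 <= M ->
  hilbert_dot H y y = hilbert_dot H z x ->
  renorm z <= M ^+ 2 * renorm x -> renorm y <= M * renorm x.
Proof.
move=> M0 yz zM.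
have yyJ : hilbert_dot H x z = hilbert_dot H y y.
  by rewrite hilbert_dotC -yz -hilbert_renorm /Num.conj/= oppr0.
rewrite le_eqVlt in M0; case/predU1P: M0 => [M0|M0].
  have z0 : z = 0.
    apply/eqP; rewrite -normr_eq0 -renormE; apply/eqP; congr (_%:C)%C.
    apply/eqP; rewrite eq_le renorm_ge0 andbT (le_trans zM)//.
    by rewrite -M0 expr0n mul0r.
  have : hilbert_dot H y y = 0 by rewrite yz z0 linear0l.
  rewrite -hilbert_renorm => /complexI/eqP; rewrite sqrf_eq0 => /eqP ->.
  by rewrite -M0 mul0r.
have := dnorm_ge0 (hilbert_dot H) ((M^-1)%:C%C *: z - M%:C%C *: x).
rewrite linearBl/= !linearBr/= !linearZl_LR/= !linearZr_LR/= yyJ -yz.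
rewrite -!hilbert_renorm.
have cr (r : R) : Num.conj (r%:C)%C = (r%:C)%C by rewrite /Num.conj/= oppr0.
have sE (a b : R[i]) : a *: (b : R[i]^o) = a * b by [].
rewrite !cr !sE -!rmorphM/= -!rmorphB/= ler0c.
rewrite mulVKf ?gt_eqF// mulKf ?gt_eqF// => h.
have h1 : M^-1 * (M^-1 * renorm z ^+ 2) <= (M * renorm x) ^+ 2.
  rewrite mulrA -invfM ler_pdivrMl ?mulr_gt0// -expr2 -exprMn.
  by rewrite ler_sqr ?nnegrE ?mulr_ge0 ?renorm_ge0// ?(ltW M0)// mulrA -expr2.
rewrite -ler_sqr ?nnegrE ?mulr_ge0 ?renorm_ge0 ?(ltW M0)//.
by rewrite exprMn !expr2 in h h1 *; lra.
Qed.

Variables (n : nat) (A : complexStarAlgType R).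
Hypothesis bounded : forall a : A, uniformly_bounded a.
Local Notation N := (@universal_norm R A).

(** The diagonal corner at [j] is a representation of [A], so for [j = i] the
    bound is immediate from the definition of [N].  For other entries, the product of [emx a i j]
    with its adjoint on the left is the diagonal element [star a ** a]. *)
Lemma rep_matrix_unit_le (H : hilbertSpace R) (rho : representation (mxStar n A) H)
    a i j x : renorm (rho (emx a i j) x) <= N a * renorm x.
Proof.
have [c cE] := cornerP A j.
have [pi piE] := representation_comp c rho.
have aa : star (emx a i j) ** emx a i j = emx (star a ** a) j j.
  by rewrite emx_star emx_mul eqxx.
apply: (@hilbert_square_bound _ _ _ (pi (star a ** a) x)).
- exact: universal_norm_ge0.
- by rewrite piE cE -aa repM [RHS]rep_star starK.
- rewrite (le_trans (rep_le_universal_norm _ _ _ _))//.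
  rewrite ler_wpM2r ?renorm_ge0// (le_trans (universal_normM _ _ _))//.
  by rewrite universal_norm_star.
Qed.

Variable A' : complexStarAlgType R.
Hypothesis bounded' : forall a : A', uniformly_bounded a.
Local Notation N' := (@universal_norm R A').
Variable f : starHom A' (mxStar n A).

(** The entry [(i, j)] is recovered from the action on columns: apply the matrix
    to the column with [x] in place [j] and read the coordinate [i]. *)
Lemma universal_norm_entry_le a i j : N (f a i j) <= N' a.
Proof.
apply: universal_norm_le; first exact: universal_norm_ge0.
move=> H pi x x1.
have [rho rhoE] := amplification n pi.
have [sigma sigmaE] := representation_comp f rho.
pose xi : hsum n H := [ffun k => if k == j then x else 0].
have xi1 : renorm xi <= 1.
  apply: le_trans x1; rewrite -lecR !renormE.
  rewrite (le_trans (hsum_norm_le_sum _))// (bigD1 j)//= ffunE eqxx.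
  rewrite big1 ?addr0// => k kj; by rewrite ffunE (negbTE kj) normr0.
have <- : (sigma a xi : hsum n H) i = pi (f a i j) x.
  rewrite sigmaE rhoE (bigD1 j)//= ffunE eqxx big1 ?addr0// => k kj.
  by rewrite ffunE (negbTE kj) -(scale0r (0 : H)) rep_scaler !scale0r.
apply: le_trans (universal_norm_ub bounded' a sigma xi1).
by rewrite -lecR !renormE hsum_coord_le.
Qed.

Hypothesis f_bij : bijective f.

Lemma universal_norm_le_entries a : N' a <= \sum_i \sum_j N (f a i j).
Proof.
have [g [fK gK]] := starHom_inverse f_bij.
apply: universal_norm_le.
  by do 2!(apply: sumr_ge0 => ? _); exact: universal_norm_ge0.
move=> H pi x x1; have [rho rhoE] := representation_comp g pi.
have renorm_sum m (F : 'I_m -> H) : renorm (\sum_k F k) <= \sum_k renorm (F k).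
  elim/big_rec2: _ => [|k y z _ yz]; first by rewrite renorm0.
  by rewrite (le_trans (renormD _ _))// lerD2l.
rewrite -(fK a) -rhoE fK [in leLHS](mx_emx_sum (f a)) rep_sum.
rewrite (le_trans (renorm_sum _ _))//; apply: ler_sum => i _.
rewrite rep_sum (le_trans (renorm_sum _ _))//; apply: ler_sum => j _.
rewrite (le_trans (rep_matrix_unit_le _ _ _ _ _))// ler_piMr//.
exact: universal_norm_ge0.
Qed.

End NormComparison.

(** * Completions of matrix algebras *)

Lemma completion_norm_le (R : realType) (A B : complexStarAlgType R)
    (N : starSeminorm A) (M : starSeminorm B) (u : cauchySeq N) (w : cauchySeq M) :
  (forall k, N (u k) <= M (w k)) ->
  completion_norm (completion_class u) <= completion_norm (completion_class w).
Proof.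
move=> uw; rewrite -(cvg_lim _ (@completion_norm_cvg _ _ _ u))//.
rewrite -(cvg_lim _ (@completion_norm_cvg _ _ _ w))//.
apply: ler_lim; [exact/snorm_cauchy_cvg/cauchySeqP..|].
by near=> k; exact: uw.
Unshelve. all: by end_near. Qed.

Section CompletionMatrix.
Variables (R : realType) (n : nat) (A' A : complexStarAlgType R).
Variables (N' : starSeminorm A') (N : starSeminorm A).
Variable f : starHom A' (mxStar n A).
Variable g : starHom (mxStar n A) A'.
Hypotheses (fK : cancel f g) (gK : cancel g f).
Hypothesis lo : forall a i j, N (f a i j) <= N' a.
Hypothesis up : forall a, N' a <= \sum_i \sum_j N (f a i j).

Local Notation C' := (cauchySeq N').
Local Notation C := (cauchySeq N).

Lemma snorm_unit_le c i j : N' (g (emx c i j)) <= N c.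
Proof.
rewrite (le_trans (up _))// gK (bigD1 i)//= (bigD1 j)//= emxE !eqxx/=.
rewrite !big1 ?addr0// => [k ki|k kj].
  by rewrite big1// => l _; rewrite emxE (negbTE ki) snorm0.
by rewrite emxE (negbTE kj) andbF snorm0.
Qed.

Fact entry_seq_subproof (u : C') i j :
  (fun k => f (u k) i j) \in snorm_cauchy_pred N.
Proof.
apply/asboolP => e e0; have [n0 h0] := cauchySeqP u e0.
exists n0 => k l k0 l0; apply: le_lt_trans (h0 k l k0 l0).
have -> : f (u k) i j - f (u l) i j = f (u k - u l) i j.
  by rewrite linearB !mxE.
exact: lo.
Qed.
Definition entry_seq (u : C') i j : C := CauchySeq (entry_seq_subproof u i j).

Fact unit_seq_subproof (c : C) i j :
  (fun k => g (emx (c k) i j)) \in snorm_cauchy_pred N'.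
Proof.
apply/asboolP => e e0; have [n0 h0] := cauchySeqP c e0.
exists n0 => k l k0 l0; apply: le_lt_trans (h0 k l k0 l0).
by rewrite -linearB -emxB; exact: snorm_unit_le.
Qed.
Definition unit_seq (c : C) i j : C' := CauchySeq (unit_seq_subproof c i j).

Lemma cauchySeq_sumE (I : Type) (r : seq I) (F : I -> C) k :
  (\sum_(i <- r) F i) k = \sum_(i <- r) F i k.
Proof. by elim/big_rec2: _ => [|i x y _ <-]. Qed.

(** The bounds [lo] and [up] make a sequence of matrices Cauchy exactly when all
    its entries are; [unit_seq] supplies the sequences with given entries. *)
Lemma cauchySeq_mx : exists F : starHom C' (mxStar n C),
  bijective F /\ forall u i j, F u i j = entry_seq u i j.
Proof.
pose F (u : C') : mxStar n C := \matrix_(i, j) entry_seq u i j.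
have FE u i j : F u i j = entry_seq u i j by rewrite mxE.
have FL : linear F.
  move=> k u w; apply/matrixP => i j; rewrite mx_addE mx_scaleE !FE.
  by apply: cauchySeq_eq => m /=; rewrite linearP mx_addE mx_scaleE.
have FM : {morph F : u w / u ** w}.
  move=> u w; apply/matrixP => i j; rewrite mx_mulE FE.
  apply: cauchySeq_eq => m /=; rewrite cauchySeq_sumE homM mx_mulE.
  by apply: eq_bigr => k _; rewrite !FE.
have FS : {morph F : u / star u}.
  move=> u; apply/matrixP => i j; rewrite mx_starE !FE.
  by apply: cauchySeq_eq => m /=; rewrite homS mx_starE.
have [h hE] := mk_starHom FL FM FS; exists h; split; last first.
  by move=> u i j; rewrite hE FE.
have h_inj : injective h.
  move=> u w; rewrite !hE => uw; apply: cauchySeq_eq => k.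
  apply: (can_inj fK); apply/matrixP => i j.
  have := congr1 (fun x : mxStar n C => x i j) uw; rewrite !FE.
  by move/(congr1 (fun v : C => v k)).
pose G (x : mxStar n C) : C' := \sum_i \sum_j unit_seq (x i j) i j.
have hG x : h (G x) = x.
  rewrite [RHS]mx_emx_sum linear_sum; apply: eq_bigr => i _ /=.
  rewrite linear_sum; apply: eq_bigr => j _ /=.
  rewrite hE; apply/matrixP => k l; rewrite FE emxE.
  by apply: cauchySeq_eq => m /=; rewrite gK emxE; case: ifP.
by exists G => // u; apply: h_inj; rewrite hG.
Qed.

Lemma nullIdeal_mx (u : C') :
  nullIdeal N' u <-> forall i j, nullIdeal N (entry_seq u i j).
Proof.
split=> [u0 i j e e0|u0].
  have [n0 h] := u0 _ e0; exists n0 => k /h; apply: le_lt_trans; exact: lo.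
have -> : u = \sum_i \sum_j unit_seq (entry_seq u i j) i j.
  have [F [Fbij FE]] := cauchySeq_mx; apply: (bij_inj Fbij).
  rewrite [LHS]mx_emx_sum linear_sum; apply: eq_bigr => i _ /=.
  rewrite linear_sum; apply: eq_bigr => j _ /=.
  apply/matrixP => k l; rewrite !FE emxE.
  by apply: cauchySeq_eq => m /=; rewrite gK emxE; case: ifP.
have sum0 (G : 'I_n -> C') : (forall k, nullIdeal N' (G k)) ->
    nullIdeal N' (\sum_k G k).
  move=> G0; elim/big_rec: _ => [|k x _ x0]; first exact: ideal0 (starIdealP _).
  by apply: (idealD (starIdealP (nullIdeal N'))) => //; exact: G0.
apply: (sum0) => i; apply: (sum0) => j e e0.
have [n0 h] := u0 i j _ e0; exists n0 => k /h; apply: le_lt_trans.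
exact: snorm_unit_le.
Qed.

(** Besides the isomorphism, the two norm estimates record that taking an entry
    and placing an element at an entry are continuous, which is needed for
    closed ideals. *)
Lemma completion_mx : exists h : starHom (completion N') (mxStar n (completion N)),
  [/\ bijective h,
      forall a i j, h (completion_in N' a) i j = completion_in N (f a i j),
      forall x i j, completion_norm (h x i j) <= completion_norm x &
      forall x c i j, h x = emx c i j -> completion_norm x <= completion_norm c].
Proof.
have [F [Fbij FE]] := cauchySeq_mx.
have FJ u : nullIdeal N' u <-> forall i j, nullIdeal N (F u i j).
  split=> [/nullIdeal_mx u0 i j|u0]; first by rewrite FE; exact: u0.
  by apply/nullIdeal_mx => i j; rewrite -FE; exact: u0.
have [h [hbij hE]] := quot_mx_iso Fbij FJ.
exists h; split=> //.
- move=> a i j; rewrite [LHS]hE FE; congr quot_proj; exact: cauchySeq_eq.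
- move=> x i j; elim/completion_ind: x => u.
  rewrite [h _ i j](hE u) FE; apply: completion_norm_le => k; exact: lo.
- move=> x c i j; elim/completion_ind: c => c hx.
  have -> : x = completion_class (unit_seq c i j).
    apply: (bij_inj hbij); rewrite hx; apply/matrixP => k l.
    rewrite [RHS]hE FE emxE.
    rewrite (_ : entry_seq _ k l = if (k == i) && (l == j) then c else 0).
      by case: ifP.
    by apply: cauchySeq_eq => m /=; rewrite gK emxE; case: ifP.
  apply: completion_norm_le => k; exact: snorm_unit_le.
Qed.

End CompletionMatrix.

Section Completion.
Variables (R : realType) (A : complexStarAlgType R) (N : starSeminorm A).

Lemma completion_inP : exists h : starHom A (completion N),
  forall a, h a = completion_in N a.
Proof.
apply: mk_starHom.
- move=> k a b; rewrite /completion_in /completion_class.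
  rewrite -(quot_projZ (nullIdeal N) k) -quot_projD.
  by congr quot_proj; exact: cauchySeq_eq.
- move=> a b; rewrite /completion_in /completion_class -quot_projM.
  by congr quot_proj; exact: cauchySeq_eq.
- move=> a; rewrite /completion_in /completion_class -quot_projS.
  by congr quot_proj; exact: cauchySeq_eq.
Qed.

End Completion.

(** * Closed ideals and the graph algebras of the doubled graph *)

Section ClosedIdeals.
Variables (R : realType) (E : sepGraph).
Variables (A' A : complexStarAlgType R) (N' : starSeminorm A') (N : starSeminorm A).
Variables (h : starHom (completion N') (mxStar 2 (completion N))).
Variables (k : starHom (mxStar 2 (completion N)) (completion N')).
Hypotheses (hK : cancel h k) (kK : cancel k h).
Hypothesis h_le : forall x i j, completion_norm (h x i j) <= completion_norm x.
Hypothesis k_le : forall x c i j, h x = emx c i j ->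
  completion_norm x <= completion_norm c.
Variables (p : sg_vertex E -> completion N) (s : sg_edge E -> completion N).
Hypothesis fam : leavitt_family p s.
Variable s' : sg_edge (doubleGraph E) -> completion N'.
Hypothesis hs : forall x, h (s' x) = double_mx_edge p s x.

Lemma entry_continuous i j :
  continuous ((fun x => h x i j) : completion N' -> completion N).
Proof.
apply: lipschitz1_continuous => x y.
have -> : h x i j - h y i j = h (x - y) i j by rewrite linearB !mxE.
by rewrite !completion_normE lecR.
Qed.

Lemma unit_continuous i j :
  continuous ((fun c => k (emx c i j)) : completion N -> completion N').
Proof.
apply: lipschitz1_continuous => x y.
rewrite -linearB -emxB !completion_normE lecR.
by apply: k_le; rewrite kK.
Qed.

(** As in the algebraic case, but minimality now also asks that the two auxiliary
    ideals be closed; they are intersections of preimages of closed ideals under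
    continuous maps. *)
Lemma closedCommutatorIdeal_entries x :
  closedCommutatorIdeal s' x <-> forall i j, closedCommutatorIdeal s (h x i j).
Proof.
pose J := closed_ideal_gen (final_commutators s).
pose J' := closed_ideal_gen (final_commutators s').
have iJ : ideal J := closed_ideal_genP _.
have iJ' : ideal J' := closed_ideal_genP _.
split=> [Jx|Jx].
  have := Jx _ (mx_entries_ideal h iJ); apply.
    rewrite (_ : [set x | _] =
      \bigcap_(ij in [set: 'I_2 * 'I_2]) (fun y => h y ij.1 ij.2) @^-1` J).
      apply: closed_bigI => ij _.
      have /continuous_closedP := @entry_continuous ij.1 ij.2; apply.
      exact: closed_ideal_gen_closed.
    apply/seteqP; split=> y /= yJ => [[i j] _|i j]; first exact: yJ.
    exact: (yJ (i, j)).
  exact: (double_commutators_entries fam hs iJ (@sub_closed_ideal_gen _ _ _ _)).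
apply: (mx_units_sum hK kK iJ') => i j.
have := Jx i j _ (mx_units_ideal hK kK iJ'); apply.
  rewrite (_ : [set c | _] =
    \bigcap_(ij in [set: 'I_2 * 'I_2]) (fun y => k (emx y ij.1 ij.2)) @^-1` J').
    apply: closed_bigI => ij _.
    have /continuous_closedP := @unit_continuous ij.1 ij.2; apply.
    exact: closed_ideal_gen_closed.
  apply/seteqP; split=> y /= yJ => [[a b] _|a b]; first exact: yJ.
  exact: (yJ (a, b)).
exact: (double_commutators_units fam hs hK kK iJ' (@sub_closed_ideal_gen _ _ _ _)).
Qed.

End ClosedIdeals.

Lemma graph_cstar_double (R : realType) (E : sepGraph) :
  star_isomorphic (graph_cstar R (doubleGraph E)) (mxStar 2 (graph_cstar R E)) /\
  star_isomorphic (tame_graph_cstar R (doubleGraph E))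
    (mxStar 2 (tame_graph_cstar R E)).
Proof.
have [f [fbij fv fe]] := leavitt_double (complex_conj R) E.
have [g [fK gK]] := starHom_inverse fbij.
pose N' := universalSeminorm (@leavitt_bounded R (doubleGraph E)).
pose N := universalSeminorm (@leavitt_bounded R E).
have lo a i j : N (f a i j) <= N' a.
  apply: universal_norm_entry_le; exact: leavitt_bounded.
have up a : N' a <= \sum_i \sum_j N (f a i j).
  by apply: universal_norm_le_entries => //; exact: leavitt_bounded.
have [h [hbij hin hlo hup]] := completion_mx fK gK lo up.
split; first exact: star_isomorphicP hbij.
have [k [hK kK]] := starHom_inverse hbij.
have [iota iotaE] := completion_inP N.
pose p v := iota (leavitt_vertex (complex_conj R) v).
have fam : leavitt_family p (@graph_cstar_edge R E).
  rewrite (_ : @graph_cstar_edge R E = iota \o @leavitt_edge _ (complex_conj R) E).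
    exact: family_image (leavitt_is_family _ _).
  by apply/funext => e; rewrite /= iotaE.
have hs x : h (graph_cstar_edge R x) = double_mx_edge p (@graph_cstar_edge R E) x.
  apply/matrixP => i j; rewrite [LHS]hin fe.
  rewrite -iotaE /p; case: x => [e|v] /=; rewrite !emxE.
    by case: ifP; rewrite ?linear0 ?iotaE.
  by case: ifP; rewrite ?linear0.
have JJ := closedCommutatorIdeal_entries hK kK hlo hup fam hs.
have [q [qbij _]] := quot_mx_iso hbij JJ.
exact: star_isomorphicP qbij.
Qed.

Lemma leavitt_ab_double (K : fieldType) (theta : involutive_rmorphism K)
    (E : sepGraph) :
  star_isomorphic (leavitt_ab theta (doubleGraph E)) (mxStar 2 (leavitt_ab theta E)).
Proof.
have [f [fbij _ fe]] := leavitt_double theta E.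
have [g [fK gK]] := starHom_inverse fbij.
have JJ := commutatorIdeal_entries (leavitt_is_family theta E) fe fK gK.
have [q [qbij _]] := quot_mx_iso fbij JJ.
exact: star_isomorphicP qbij.
Qed.

Theorem proposition9p1 (R : realType) (K : fieldType)
    (theta : involutive_rmorphism K) (E : sepGraph) :
  exists E' : sepGraph,
    [/\ bipartite E',
        star_isomorphic (leavitt theta E') (mxStar 2 (leavitt theta E)),
        star_isomorphic (graph_cstar R E') (mxStar 2 (graph_cstar R E)),
        star_isomorphic (leavitt_ab theta E') (mxStar 2 (leavitt_ab theta E)) &
        star_isomorphic (tame_graph_cstar R E')
          (mxStar 2 (tame_graph_cstar R E))].
Proof.
have [f [fbij _ _]] := leavitt_double theta E.
have [cstarE tameE] := graph_cstar_double R E.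
exists (doubleGraph E); split=> //.
- exact: double_bipartite.
- exact: star_isomorphicP fbij.
- exact: leavitt_ab_double.
Qed.
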